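(* Let $X$ be a Gromov-hyperbolic space whose Gromov closure $\overline{X}=X\cup\partial X$ is compact, and let $\Gamma$ be a semigroup of isometries of $X$ whose limit set $\Lambda_\Gamma$ contains at least two points. Then $$\sup_{\Gamma'} \delta_{\Gamma'} = h_\Gamma ,$$ where the supremum is taken over all sub-semigroups $\Gamma'$ of $\Gamma$ that are Schottky semigroups.
   Context: Let $X$ be a metric space with base point $o$. The Gromov product is $(x|y)=\frac12(d(x,o)+d(y,o)-d(x,y))$. $X$ is $\delta$-hyperbolic if $(x|z)\ge\min\{(x|y),(y|z)\}-\delta$ for all $x,y,z\in X$, and Gromov-hyperbolic if it is $\delta$-hyperbolic for some $\delta\ge 0$ ($X$ is not assumed geodesic). $\mathrm{Isom}(X)$ is the isometry group; a semigroup of isometries is a subset of $\mathrm{Isom}(X)$ closed under composition; a generating set generates by non-empty products. Boundary: a sequence $(x_i)$ in $X$ is convergent if $\lim_{i,j\to\infty}(x_i|x_j)=\infty$. For $A\subseteq X$, $\partial A$ is the set of convergent sequences of $A$ modulo $(x_i)\sim(y_j)$ iff $\lim_{i,j\to\infty}(x_i|y_j)=\infty$. The Gromov product extends to $\overline X=X\cup\partial X$ by $(\xi|\eta)=\sup_{x_i\to\xi,\,y_j\to\eta}\liminf_{i,j\to\infty}(x_i|y_j)$. $\overline X$ has the topology with neighbourhood basis given by the open balls $B(x,r)$ of $X$ and the sets $\{x\in\overline X : (x|\xi)>-\log r\}$, $\xi\in\partial X$. $\overline X$ is compact iff $X$ is proper (closed balls are compact) with compact boundary. The limit set of $\Gamma$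 is $\Lambda_\Gamma=\partial(\Gamma o)$. Critical exponent and entropy: for $P\subseteq X$, $\delta_P=\limsup_{n\to\infty}\frac1n\log\#(B(o,n)\cap P)$. A subset $S\subseteq X$ is separated if there is $\epsilon>0$ with $d(x,y)>\epsilon$ for all $x\ne y$ in $S$. The entropy of $P\subseteq X$ is $h_P=\sup_S\delta_{P\cap S}$, over all separated $S\subseteq X$ (with $h_\emptyset=0$; it may be infinite). For $A\subseteq\mathrm{Isom}(X)$, $\delta_A=\delta_{Ao}$ and $h_A=h_{Ao}$. Gromov-disjoint: two subsets $A,B$ of $X$ are Gromov-disjoint if their closures in $X$ are disjoint and $\sup_{(a,b)\in A\times B}(a|b)<C$ for some constant $C>0$. Schottky semigroup: a semigroup $\Gamma'$ of isometries of $X$ is Schottky if there is a subset $X_+\subseteq X$ and a finite generating set $\{g_1,\dots,g_n\}$ of $\Gamma'$ such that $g_1X_+,\dots,g_nX_+$ and $X\setminus X_+$ are pairwise Gromov-disjoint and $X_+\setminus(g_1X_+\cup\dots\cup g_nX_+)$ has non-empty interior. *)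

(* Defs.v *)
From HB Require Import structures.
From mathcomp Require Import all_boot all_order all_algebra.
From mathcomp Require Import all_classical all_reals all_analysis.
Import Order.TTheory GRing.Theory Num.Theory.
Import numFieldNormedType.Exports.

Set Implicit Arguments.
Unset Strict Implicit.
Unset Printing Implicit Defensive.

Local Open Scope classical_set_scope.
Local Open Scope ring_scope.

Definition gromov_product (R : realType) (X : metricType R) (o x y : X) : R :=
  (mdist x o + mdist y o - mdist x y) / 2.

Definition gromov_hyperbolic (R : realType) (X : metricType R) (o : X) : Prop :=
  exists2 delta : R, 0 <= delta &
    forall x y z : X,
      Num.min (gromov_product o x y) (gromov_product o y z) - delta
        <= gromov_product o x z.

Section Boundary.
Variables (R : realType) (X : metricType R) (o : X).

Definition gromov_equiv (u v : nat -> X) : Prop :=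
  gromov_product o (u ij.1) (v ij.2) @[ij --> filter_prod \oo \oo] --> +oo%R.

Definition gromov_convergent (u : nat -> X) : Prop := gromov_equiv u u.

(* A boundary point is the set of all convergent sequences equivalent to a
   given one. On a hyperbolic space [gromov_equiv] is an equivalence relation
   on convergent sequences, so these sets are its classes. *)
Record boundary : Type := Boundary {
  boundary_class : set (nat -> X);
  boundary_classP : exists2 u, gromov_convergent u &
    boundary_class = [set v | gromov_convergent v /\ gromov_equiv u v] }.

HB.instance Definition _ := gen_eqMixin boundary.
HB.instance Definition _ := gen_choiceMixin boundary.

(* The boundary of A, as a subset of the boundary of X. *)
Definition boundary_of (A : set X) : set boundary :=
  [set xi | exists2 u, boundary_class xi u & forall i, A (u i)].

Definition gromov_closure : Type := (X + boundary)%type.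

HB.instance Definition _ := Choice.on gromov_closure.

Definition seq_tends_to (u : nat -> X) (p : gromov_closure) : Prop :=
  match p with
  | inl x => u @ \oo --> x
  | inr xi => boundary_class xi u
  end.

Definition gromov_product_ext (p q : gromov_closure) : \bar R :=
  ereal_sup
    [set limf_einf (fun ij : nat * nat => (gromov_product o (uv.1 ij.1) (uv.2 ij.2))%:E)
           (filter_prod \oo \oo)
    | uv in [set uv : (nat -> X) * (nat -> X) |
              seq_tends_to uv.1 p /\ seq_tends_to uv.2 q]].

Definition basic_nbhd (p : gromov_closure) (r : R) : set gromov_closure :=
  match p with
  | inl x => inl @` ball x r
  | inr xi => [set q | ((- ln r)%:E < gromov_product_ext q (inr xi))%E]
  end.

Lemma basic_nbhd_le p r s : 0 < r -> r <= s -> basic_nbhd p r `<=` basic_nbhd p s.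
Proof.
move=> r0 rs; case: p => [x|xi] /=.
  by apply: image_subset; exact: le_ball.
move=> q /=; apply: le_lt_trans.
by rewrite lee_fin lerN2 ler_ln // posrE // (lt_le_trans r0).
Qed.

(* The topology for which the basic sets at p form a neighbourhood basis of p.
   Basic sets at boundary points need not be open themselves. *)
Definition gromov_open : set (set gromov_closure) :=
  [set U | forall p, U p -> exists2 r : R, 0 < r & basic_nbhd p r `<=` U].

Lemma gromov_openT : gromov_open setT.
Proof. by move=> p _; exists 1. Qed.

Lemma gromov_openI : setI_closed gromov_open.
Proof.
move=> A B Ao Bo p [/Ao[r r0 rA] /Bo[s s0 sB]].
have m0 : 0 < Num.min r s by rewrite lt_min r0.
exists (Num.min r s) => // q pq; split.
  by apply/rA/(basic_nbhd_le m0 _ pq); rewrite ge_min lexx.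
by apply/sB/(basic_nbhd_le m0 _ pq); rewrite ge_min lexx orbT.
Qed.

Lemma gromov_open_bigU (I : Type) (f : I -> set gromov_closure) :
  (forall i, gromov_open (f i)) -> gromov_open (\bigcup_i f i).
Proof.
move=> fo p [i _ /fo[r r0 rf]]; exists r => // q /rf; by exists i.
Qed.

HB.instance Definition _ := isOpenTopological.Build gromov_closure
  gromov_openT gromov_openI gromov_open_bigU.

End Boundary.

Arguments boundary_of {R X} o A _ : rename.

Definition is_isometry (R : realType) (X : metricType R) (f : X -> X) : Prop :=
  bijective f /\ forall x y, mdist (f x) (f y) = mdist x y.

Definition isometry_semigroup (R : realType) (X : metricType R)
    (G : set (X -> X)) : Prop :=
  (forall f, G f -> is_isometry f) /\ (forall f g, G f -> G g -> G (f \o g)).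

Definition orbit_set (X : Type) (G : set (X -> X)) (o : X) : set X :=
  [set f o | f in G].

Definition limit_set (R : realType) (X : metricType R) (o : X)
    (G : set (X -> X)) : set (boundary o) :=
  boundary_of o (orbit_set G o).
Arguments limit_set {R X} o G _ : rename.

(* [lne 0 = -oo] and [lne +oo = +oo]; the value at n = 0 does not affect the
   upper limit. *)
Definition crit_exponent_set (R : realType) (X : metricType R) (o : X)
    (P : set X) : \bar R :=
  limn_esup (fun n => ((n%:R : R)^-1)%:E * lne (counting (ball o n%:R `&` P)))%E.

Definition separated_set (R : realType) (X : metricType R) (S : set X) : Prop :=
  exists2 e : R, 0 < e & forall x y, S x -> S y -> x <> y -> e < mdist x y.

Definition entropy_set (R : realType) (X : metricType R) (o : X)
    (P : set X) : \bar R :=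
  if `[< P = set0 >] then 0%E else
  ereal_sup [set crit_exponent_set o (P `&` S) | S in @separated_set R X].

Definition crit_exponent (R : realType) (X : metricType R) (o : X)
    (G : set (X -> X)) : \bar R :=
  crit_exponent_set o (orbit_set G o).

Definition entropy (R : realType) (X : metricType R) (o : X)
    (G : set (X -> X)) : \bar R :=
  entropy_set o (orbit_set G o).

Definition gromov_disjoint (R : realType) (X : metricType R) (o : X)
    (A B : set X) : Prop :=
  closure A `&` closure B = set0 /\
  exists2 C : R, 0 < C &
    (ereal_sup [set (gromov_product o ab.1 ab.2)%:E | ab in A `*` B] < C%:E)%E.

Definition word_map (X I : Type) (g : I -> X -> X) (w : seq I) : X -> X :=
  foldr (fun i f => g i \o f) id w.

Definition generated_semigroup (X : Type) (I : eqType) (g : I -> X -> X) :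
    set (X -> X) :=
  [set word_map g w | w in [set w : seq I | w != [::]]].

Definition schottky_semigroup (R : realType) (X : metricType R) (o : X)
    (G : set (X -> X)) : Prop :=
  isometry_semigroup G /\
  exists (Xp : set X) (n : nat) (g : 'I_n -> X -> X),
    [/\ (0 < n)%N,
        G = generated_semigroup g,
        (forall i j, i != j -> gromov_disjoint o (g i @` Xp) (g j @` Xp)),
        (forall i, gromov_disjoint o (g i @` Xp) (~` Xp)) &
        interior (Xp `\` \bigcup_i (g i @` Xp)) !=set0].

(* Main.v *)
Require Import Defs.
From mathcomp Require Import all_boot all_order all_algebra.
From mathcomp Require Import finmap.
From mathcomp Require Import all_classical all_reals all_analysis.
From mathcomp Require Import ring lra.
Import Order.TTheory GRing.Theory Num.Theory.

(** Write [(x|y)] for the Gromov product and [|x|] for the distance of [x] to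
    the base point [o].

    Upper bound. For a Schottky semigroup, ping-pong makes the images of a small
    ball under distinct elements disjoint, so the orbit of the centre [x] of
    that ball is separated. Balls are totally bounded ([separated_bounded]), so
    boundedly many elements move [o] into any given ball of radius 1, and a
    maximal 1-separated subset of the orbit of [o] has the growth of the whole
    orbit ([schottky_exponent_le_entropy]).

    Lower bound. Fix [c] below the entropy. The sets of isometries whose orbit
    points have growth rate larger than [c] ([growing]) are stable under
    supersets, and when a union of two sets is growing, so is one of the two.
    Hence there is an ultrafilter of growing subsets of the semigroup [G]
    ([grill_ultrafilter]). By compactness of the Gromov closure, along this
    ultrafilter the points [a o] tend to an attracting boundary point [xi] and
    the points [a^-1 o] to a repelling boundary point [eta].

    If some [h] in [G], or the identity, satisfies [h xi <> eta], then for deep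
    [a] the isometries [h a] map the complement of a neighbourhood of [eta] into
    a neighbourhood of [h xi]. Those in one annulus with orbit points far apart
    have disjoint images, so they generate a Schottky semigroup
    ([ping_pong], [schottky_of_ultrafilter]); thinning out the family costs only
    a constant factor, and the exponent is at least [c].

    Otherwise [xi = eta] is fixed by [G]. As there are two limit points, [G]
    contains a long [g] for which [g o] is far from [xi]; it repels from [xi].
    For every [a], a power of [g], of exponent at most linear in [|a o|], moves
    [a o] out of a fixed neighbourhood of [xi] without increasing [|a o|]
    ([iterate_away]). So the elements of [G] whose orbit points avoid that
    neighbourhood are still growing ([growing_away]). An ultrafilter of growing
    sets of such elements has its attracting point away from [xi], and this
    point cannot be the repelling one as well, because the elements fix [xi]
    ([schottky_of_fixed_point]). The first case then applies with [h] the
    identity. *)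

Local Open Scope classical_set_scope.

Set Implicit Arguments.
Unset Strict Implicit.
Unset Printing Implicit Defensive.

(** * Gromov products and isometries *)

Section GromovProduct.
Local Open Scope ring_scope.
Variables (R : realType) (X : metricType R) (o : X).
Local Notation gp := (gromov_product o).
Implicit Types (x y z : X) (f : X -> X).

Lemma gpC x y : gp x y = gp y x.
Proof. by rewrite /gromov_product (metric_sym x y) (addrC (mdist x o)). Qed.

Lemma gp_ge0 x y : 0 <= gp x y.
Proof.
have := metric_triangle x o y; rewrite /gromov_product (metric_sym o y); lra.
Qed.

Lemma gp_le x y : gp x y <= mdist x o.
Proof.
have := metric_triangle y x o; rewrite /gromov_product (metric_sym y x); lra.
Qed.

Lemma gpxx x : gp x x = mdist x o.
Proof. rewrite /gromov_product mdistxx; lra. Qed.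

Lemma gp_lipl x x' y : gp x y <= gp x' y + mdist x x'.
Proof.
have := metric_triangle x x' o; have := metric_triangle x' x y.
rewrite /gromov_product (metric_sym x' x); lra.
Qed.

Lemma gp_lipr x y y' : gp x y <= gp x y' + mdist y y'.
Proof. rewrite (gpC x y) (gpC x y'); exact: gp_lipl. Qed.

(** The point from which [f] reaches the base point, so that orbits of the
    inverse isometries can be discussed without forming inverses. *)
Definition base_preimage f : X := xget o [set x | f x = o].

Section Isometry.
Variables (f : X -> X) (f_iso : is_isometry f).
Let f_dist x y : mdist (f x) (f y) = mdist x y.
Proof. exact: f_iso.2. Qed.

Lemma base_preimageK : f (base_preimage f) = o.
Proof.
rewrite /base_preimage; case: xgetP => // nex.
by have [[g _ fK] _] := f_iso; have := nex (g o); rewrite /= fK.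
Qed.

Lemma mdist_base_preimage : mdist (base_preimage f) o = mdist (f o) o.
Proof. by rewrite -f_dist base_preimageK metric_sym. Qed.

Lemma mdist_isometry x :
  mdist (f x) o = mdist x o + mdist (f o) o - 2 * gp x (base_preimage f).
Proof.
rewrite /gromov_product mdist_base_preimage -{1}base_preimageK f_dist; lra.
Qed.

(** The identity behind every contraction estimate: [f] sends the points
    seen from [base_preimage f] under a small product deep into the shadow of
    [f o]. *)
Lemma gp_shadow x :
  gp (f o) (f x) = mdist (f o) o - gp (base_preimage f) x.
Proof.
have := mdist_isometry x; rewrite (gpC (base_preimage f)).
by rewrite {2}/gromov_product f_dist (metric_sym o x); lra.
Qed.

Lemma gp_isometry_ge x y : gp x y - mdist (f o) o <= gp (f x) (f y).
Proof.
have := metric_triangle x (base_preimage f) o.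
have := metric_triangle y (base_preimage f) o.
have fo z : mdist (f z) o = mdist z (base_preimage f).
  by rewrite -{1}base_preimageK f_dist.
by rewrite mdist_base_preimage /gromov_product f_dist !(fo x) !(fo y); lra.
Qed.

End Isometry.

Lemma isometry_id : is_isometry (id : X -> X).
Proof. by split => //; exists id. Qed.

Lemma isometry_comp f g :
  is_isometry f -> is_isometry g -> is_isometry (f \o g).
Proof.
move=> [fb fd] [gb gd]; split; first exact: bij_comp.
by move=> x y /=; rewrite fd gd.
Qed.

Lemma base_preimage_comp f g : is_isometry f -> is_isometry g ->
  mdist (base_preimage (f \o g)) (base_preimage g) = mdist (f o) o.
Proof.
move=> fi gi; have := base_preimageK (isometry_comp fi gi) => /= fgK.
by rewrite -gi.2 (base_preimageK gi) -fi.2 fgK metric_sym.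
Qed.

End GromovProduct.

(** * Boundary and compactness *)

Section Hyperbolic.
Local Open Scope ring_scope.
Variables (R : realType) (X : metricType R) (o : X) (dl : R).
Hypothesis dl_ge0 : 0 <= dl.
Hypothesis dlP : forall x y z : X,
  Num.min (gromov_product o x y) (gromov_product o y z) - dl
    <= gromov_product o x z.
Local Notation gp := (gromov_product o).
Implicit Types (x y z : X) (u v : nat -> X) (xi eta : boundary o).

Lemma gp_chain t x y z : t <= gp x y -> t <= gp y z -> t - dl <= gp x z.
Proof.
move=> txy tyz; apply: le_trans (dlP x y z).
by rewrite lerB// le_min txy tyz.
Qed.

Lemma gp_chain3 t x y z w :
  t <= gp x y -> t <= gp y z -> t <= gp z w -> t - 2 * dl <= gp x w.
Proof.
move=> txy tyz tzw; have h := gp_chain tyz tzw.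
have h' : t - dl <= gp x y by have := dl_ge0; lra.
by have := gp_chain h' h; lra.
Qed.

Lemma gromov_equivP u v : gromov_equiv o u v <->
  forall r, exists N, forall i j, (N <= i)%N -> (N <= j)%N ->
    r <= gp (u i) (v j).
Proof.
rewrite /gromov_equiv; split.
  move/cvgryPge => h r; have [[A B] /= [[n _ An] [m _ Bm]] AB] := h r.
  exists (maxn n m) => i j; rewrite !geq_max => /andP[ni mi] /andP[nj mj].
  by apply: (AB (i, j)); split; [exact: An|exact: Bm].
move=> h; apply/cvgryPge => r; have [N hN] := h r.
exists ([set k | (N <= k)%N], [set k | (N <= k)%N]) => /=.
  by split; exists N.
by case=> i j /= [Ni Nj]; exact: hN.
Qed.

Lemma gromov_equiv_sym u v : gromov_equiv o u v -> gromov_equiv o v u.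
Proof.
move=> /gromov_equivP h; apply/gromov_equivP => r; have [N hN] := h r.
by exists N => i j Ni Nj; rewrite gpC hN.
Qed.

Lemma gromov_equiv_trans u v w :
  gromov_equiv o u v -> gromov_equiv o v w -> gromov_equiv o u w.
Proof.
move=> /gromov_equivP h1 /gromov_equivP h2; apply/gromov_equivP => r.
have [N1 hN1] := h1 (r + dl); have [N2 hN2] := h2 (r + dl).
exists (maxn N1 N2) => i j; rewrite !geq_max => /andP[ni mi] /andP[nj mj].
have := gp_chain (hN1 i (maxn N1 N2) ni (leq_maxl _ _))
  (hN2 (maxn N1 N2) j (leq_maxr _ _) mj).
by lra.
Qed.

Lemma boundary_class_equiv xi u v :
  boundary_class xi u -> boundary_class xi v -> gromov_equiv o u v.
Proof.
have [a _ ->] := boundary_classP xi; move=> [_ au] [_ av].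
exact: gromov_equiv_trans (gromov_equiv_sym au) av.
Qed.

Lemma boundary_class_convergent xi u :
  boundary_class xi u -> gromov_convergent o u.
Proof. by have [a _ ->] := boundary_classP xi; case. Qed.

Lemma boundary_class_inj xi eta u v : boundary_class xi u ->
  boundary_class eta v -> gromov_equiv o u v -> xi = eta.
Proof.
move=> xu ev uv; have : boundary_class xi = boundary_class eta.
  have [a _ xE] := boundary_classP xi; have [b _ eE] := boundary_classP eta.
  move: xu ev; rewrite xE eE => -[_ au] [_ bv].
  have ab : gromov_equiv o a b.
    apply: gromov_equiv_trans au (gromov_equiv_trans uv _).
    exact: gromov_equiv_sym.
  apply/seteqP; split => w [cw wE]; split => //.
    exact: gromov_equiv_trans (gromov_equiv_sym ab) wE.
  exact: gromov_equiv_trans ab wE.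
case: xi eta {xu ev} => A AP [B BP] /= AB; subst B.
by congr Boundary; exact: Prop_irrelevance.
Qed.

(** A lower bound [r] for [gromov_product_ext q (inr xi)], witnessed by
    sequences: unlike a supremum of lower limits, this form composes. *)
Definition gromov_near (q : gromov_closure o) xi (r : R) : Prop :=
  exists u v N, [/\ seq_tends_to u q, boundary_class xi v &
    forall i j, (N <= i)%N -> (N <= j)%N -> r <= gp (u i) (v j)].

Lemma basic_nbhd_near xi (r : R) (q : gromov_closure o) :
  basic_nbhd (inr xi) r q -> gromov_near q xi (- ln r).
Proof.
move=> /= /ereal_sup_gt[_ [[u v] /= [uq vx] <-]].
rewrite limf_einfE => /ereal_sup_gt[_ [V FV <-]] rV.
have [[A B] /= [[n _ An] [m _ Bm]] AB] := FV.
exists u, v, (maxn n m); split => // i j.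
rewrite !geq_max => /andP[ni mi] /andP[nj mj].
rewrite -lee_fin; apply: (le_trans (ltW rV)); apply: ereal_inf_lbound.
by exists (i, j) => //; apply: AB; split; [exact: An|exact: Bm].
Qed.

Lemma gromov_near_inl x xi r : gromov_near (inl x) xi r ->
  exists v N, boundary_class xi v /\
    forall j, (N <= j)%N -> r - 1 <= gp x (v j).
Proof.
move=> [u [v [N [/= ux vx h]]]]; exists v, N; split => // j Nj.
have [n _ hn] := metricType_numDomainType.cvgr_dist_le ux ltr01.
have := hn (maxn n N) (leq_maxl _ _); have := h _ j (leq_maxr n N) Nj.
have := gp_lipl o (u (maxn n N)) x (v j); rewrite (metric_sym _ x) => /=; lra.
Qed.

Lemma gromov_near_ball x y xi r : gromov_near (inl x) xi r ->
  mdist x y < 1 -> gromov_near (inl y) xi (r - 2).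
Proof.
move=> /gromov_near_inl[v [N [vx h]]] xy; exists (fun=> y), v, N; split => //.
  exact: cvg_cst.
move=> _ j _ Nj; have := h j Nj; have := gp_lipl o x y (v j); lra.
Qed.

Lemma gromov_near_trans q xi eta r : gromov_near (inr eta) xi r ->
  gromov_near q eta r -> gromov_near q xi (r - 2 * dl).
Proof.
move=> [u [v [N [/= ue vx h]]]] [u' [v' [N' [uq ve h']]]].
have [M hM] := (gromov_equivP _ _).1 (boundary_class_equiv ve ue) r.
exists u', v, (maxn N N'); split => // i j.
rewrite !geq_max => /andP[ni mi] /andP[nj mj].
apply: (@gp_chain3 _ _ (v' (maxn M N')) (u (maxn M N))).
- by apply: h' => //; exact: leq_maxr.
- by apply: hM; exact: leq_maxl.
- by apply: h => //; exact: leq_maxr.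
Qed.

Lemma gromov_near_gp x y xi r : gromov_near (inl x) xi r ->
  gromov_near (inl y) xi r -> r - 1 - 2 * dl <= gp x y.
Proof.
move=> /gromov_near_inl[v [N [vx h]]] /gromov_near_inl[w [M [wx k]]].
have [L hL] := (gromov_equivP _ _).1 (boundary_class_equiv vx wx) (r - 1).
apply: (@gp_chain3 _ _ (v (maxn L N)) (w (maxn L M))).
- by apply: h; exact: leq_maxr.
- by apply: hL; exact: leq_maxl.
- by rewrite gpC; apply: k; exact: leq_maxr.
Qed.

(** The complement of the closure of [A] in the Gromov closure, described by
    neighbourhoods that only see points of [X]. *)
Definition gromov_exterior (A : set X) : set (gromov_closure o) :=
  [set q | match q with
           | inl x => exists2 e : R, 0 < e & ball x e `&` A = set0
           | inr eta => exists r, forall x, A x -> ~ gromov_near (inl x) eta r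
           end].

(** Basic sets at boundary points need not be open, and the exterior of a set
    is what replaces them: it is open because the relation of being near a
    boundary point is transitive up to a bounded loss. *)
Lemma gromov_exterior_open A : open (gromov_exterior A).
Proof.
suff : gromov_open (gromov_exterior A) by [].
case=> [x [e e0 xA]|eta [r rA]].
  exists (e / 2); first by rewrite divr_gt0.
  move=> _ [y xy <-] /=; exists (e / 2); first by rewrite divr_gt0.
  rewrite -subset0 => z [yz Az]; rewrite -[X in X z]xA; split => //.
  exact: ball_split xy yz.
have near_le q s t : s <= t -> gromov_near q eta t -> gromov_near q eta s.
  move=> st [u [v [N [? ? h]]]]; exists u, v, N; split => // i j Ni Nj.
  exact: le_trans st (h _ _ Ni Nj).
have dl0 := dl_ge0; pose t := Num.max r 0 + 2 + 2 * dl.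
have r_t : r <= Num.max r 0 by rewrite le_max lexx.
exists (expR (- t)); first exact: expR_gt0.
move=> q /basic_nbhd_near; rewrite expRK opprK; case: q => [x xt|zeta zt] /=.
  exists 1 => //; rewrite -subset0 => y [xy Ay]; apply: (rA y Ay).
  have {}xy : mdist x y < 1 by move: xy; rewrite ballEmdist.
  apply: near_le (gromov_near_ball xt xy); rewrite /t; lra.
exists t => x Ax xz; apply: (rA x Ax).
by apply: near_le (gromov_near_trans zt xz); rewrite /t; lra.
Qed.

(** Compactness of the Gromov closure enters the proof only through this
    alternative: along an ultrafilter, points either converge in [X] or have
    arbitrarily large mutual Gromov products. *)
Lemma ultrafilter_alternative (T : Type) (U : set_system T) (f : T -> X) :
  compact [set: gromov_closure o] -> UltraFilter U ->
  (exists x, forall e : R, 0 < e -> U [set t | mdist x (f t) < e]) \/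
  (forall r, exists2 A, U A & forall a b, A a -> A b -> r <= gp (f a) (f b)).
Proof.
move=> cpt UU; pose F := [set B : set (gromov_closure o) | U [set t | B (inl (f t))]].
have FF : ProperFilter F.
  split; first exact: filter_not_empty.
  split; [exact: filterT|by move=> A B; exact: filterI|].
  by move=> A B AB; apply: filterS => t; exact: AB.
have not_ext p A : cluster F p -> U (f @^-1` A) -> ~ gromov_exterior A p.
  move=> pF UA pA.
  have FA : U [set t | (inl @` A) (inl (f t) : gromov_closure o)].
    by apply: filterS UA => t At; exists (f t).
  have nA : nbhs p (gromov_exterior A).
    by apply: open_nbhs_nbhs; split => //; exact: gromov_exterior_open.
  have [_ [[x Ax <-] [e e0 xA]]] := pF _ _ FA nA.
  by rewrite -[False]/(set0 x) -xA; split => //; exact: ballxx.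
have [p [_ pF]] := cpt F FF (filterT).
case: p pF => [x|xi] pF; [left; exists x => e e0|right => r].
  have [//|Uc] := in_ultra_setVsetC [set t | mdist x (f t) < e] UU.
  case: (not_ext _ [set y | ~ mdist x y < e] pF Uc); exists e => //.
  by rewrite -subset0 => y []; rewrite ballEmdist.
pose A := [set x | gromov_near (inl x) xi (r + 1 + 2 * dl)].
exists (f @^-1` A); last first.
  by move=> a b Aa Ab; have := gromov_near_gp Aa Ab; lra.
have [//|Uc] := in_ultra_setVsetC (f @^-1` A) UU.
by case: (not_ext _ (~` A) pF Uc); exists (r + 1 + 2 * dl).
Qed.

End Hyperbolic.

(** * Ultrafilters, finite selection and growth estimates *)

(** The sets whose complement in [A0] fails [P] form a filter, and a set of an
    ultrafilter extending it cannot fail [P] itself. *)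
Lemma grill_ultrafilter (T : Type) (P : set T -> Prop) (A0 : set T) :
  (forall A B, A `<=` B -> P A -> P B) ->
  (forall A B, P (A `|` B) -> P A \/ P B) ->
  P A0 -> ~ P set0 ->
  exists U : set_system T, [/\ UltraFilter U, U A0 & forall A, U A -> P A].
Proof.
move=> PS PU PA0 nP0; pose F : set_system T := [set A | ~ P (A0 `\` A)].
have FF : ProperFilter F.
  split; first by rewrite /F /= setD0; apply.
  split; first by rewrite /F /= setDT.
    move=> A B FA FB; rewrite /F /= setDIr => /PU[]; [exact: FA|exact: FB].
  move=> A B AB FA; rewrite /F /= => PB; apply: FA.
  by apply: PS PB => x [? nB]; split => // /AB.
have [U [UU FU]] := ultraFilterLemma FF.
exists U; split => //; first by apply: FU; rewrite /F /= setDv.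
move=> A UA; apply: contrapT => nPA.
have : U (~` A).
  by apply: FU; rewrite /F /= setDE setCK => PA; apply: nPA; apply: PS PA => x [].
move=> UcA; have : U (A `&` ~` A) by exact: filterI.
by move=> /filter_ex[x []].
Qed.

Lemma ultra_meet (T : Type) (U : set_system T) (A B : set T) :
  UltraFilter U -> U A -> U B -> exists x, A x /\ B x.
Proof.
move=> UU UA UB; have : U (A `&` B) by exact: filterI.
by move=> /filter_ex[x []]; exists x.
Qed.

Section FiniteSelection.
Local Open Scope set_scope.
Implicit Types T S : finType.

Lemma card_le_fibers T S (c : T -> S) (J : {set S}) (K : nat) :
  (forall t, c t \in J) -> (forall s, s \in J -> #|[set t | c t == s]| <= K)%N ->
  (#|T| <= K * #|J|)%N.
Proof.
move=> cJ cK; have -> : #|T| = (\sum_(t : T) 1)%N by rewrite sum1_card.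
rewrite (partition_big c (mem J)) //=.
rewrite mulnC -sum_nat_const; apply: leq_sum => s sJ.
by rewrite sum1dep_card; exact: cK.
Qed.

Lemma large_fiber T S (c : T -> S) : (0 < #|T|)%N ->
  exists t0, (#|T| <= #|[set t | c t == c t0]| * #|S|)%N.
Proof.
move=> /card_gt0P[t1 _].
have [t0 _ t0max] := @arg_maxnP _ t1 xpredT (fun t => #|[set s | c s == c t]|) isT.
exists t0; apply: leq_trans (leq_mul (leqnn _) (max_card (mem [set c t | t in T]))).
apply: (@card_le_fibers _ _ c) => [t|_ /imsetP[t _ ->]]; first exact: imset_f.
exact: t0max.
Qed.

(** The neighbourhoods of the points of a maximal independent set cover [T]. *)
Lemma independent_subset T (r : rel T) (K : nat) :
  (forall t, r t t) -> (forall s t, r s t -> r t s) ->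
  (forall t, #|[set s | r t s]| <= K)%N ->
  exists2 J : {set T}, {in J &, forall s t, s != t -> ~~ r s t} &
    (#|T| <= K * #|J|)%N.
Proof.
move=> rxx rC rK.
pose P (J : {set T}) := [forall s in J, forall t in J, (s != t) ==> ~~ r s t].
have P0 : P finset.set0 by apply/forall_inP => s; rewrite inE.
have [J /maxsetP[PJ Jmax] _] := maxset_exists P0.
have indep : {in J &, forall s t, s != t -> ~~ r s t}.
  move=> s t sJ tJ st; move/forall_inP: PJ => /(_ _ sJ)/forall_inP/(_ _ tJ).
  by move=> /implyP/(_ st).
exists J => //.
have cover t : {s | (s \in J) && r s t}.
  apply: sigW; apply: contrapT => nt.
  have nr s : s \in J -> ~~ r s t.
    by move=> sJ; apply/negP => rst; apply: nt; exists s; rewrite sJ.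
  have /Jmax tJ : P (t |: J)%SET.
    apply/forall_inP => a; rewrite !inE => /orP[/eqP ->|aJ];
      apply/forall_inP => b; rewrite !inE => /orP[/eqP ->|bJ]; apply/implyP => ab.
    - by rewrite eqxx in ab.
    - by apply/negP => /rC; apply/negP; exact: nr.
    - exact: nr.
    - exact: indep.
  have : t \in J by rewrite -(tJ (finset.subsetUr _ _)) finset.setU11.
  by move=> /nr; rewrite rxx.
apply: (@card_le_fibers _ _ (fun t => sval (cover t))) => [t|s sJ].
  by case/andP: (svalP (cover t)).
apply: leq_trans (rK s); apply: subset_leq_card; apply/fintype.subsetP => t.
by rewrite !inE => /eqP <-; case/andP: (svalP (cover t)).
Qed.

End FiniteSelection.

Section Growth.
Local Open Scope ring_scope.
Variables (R : realType).

(** Squaring [x / 2 <= expR (x / 2)] gives quadratic growth. *)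
Lemma affine_le_expR (a b c : R) : 0 < c ->
  exists N : nat, forall n, (N <= n)%N -> a + b * n%:R <= expR (c * n%:R).
Proof.
move=> c0; pose d := (`|a| + `|b| + 1) * 4 / c ^+ 2.
have d0 : 0 <= d by rewrite divr_ge0 ?mulr_ge0 ?exprn_ge0 ?addr_ge0 // ltW.
exists (Num.truncn d).+1 => n dn.
have nd : d <= n%:R.
  have /andP[_ /ltW h] := truncn_itv d0; apply: le_trans h _.
  by rewrite ler_nat.
have n1 : 1 <= n%:R :> R by rewrite ler1n; apply: leq_trans dn.
have cn0 : 0 <= c * n%:R / 2 by rewrite !mulr_ge0 // ltW.
have -> : c * n%:R = c * n%:R / 2 + c * n%:R / 2 by lra.
rewrite expRD; apply: (@le_trans _ _ ((c * n%:R / 2) * (c * n%:R / 2))); last first.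
  have h : c * n%:R / 2 <= expR (c * n%:R / 2).
    by have := expR_ge1Dx (c * n%:R / 2); lra.
  by apply: ler_pM.
have -> : c * n%:R / 2 * (c * n%:R / 2) = c ^+ 2 / 4 * n%:R * n%:R by field.
apply: (@le_trans _ _ ((`|a| + `|b| + 1) * n%:R)).
  have := ler_norm a; have := ler_norm b; have := normr_ge0 a; have := normr_ge0 b.
  nra.
rewrite ler_wpM2r //; move: nd; rewrite /d ler_pdivrMr ?exprn_gt0 //; lra.
Qed.

End Growth.

Section Compactness.
Local Open Scope ring_scope.
Variables (R : realType) (X : metricType R) (o : X) (dl : R).
Hypothesis dl_ge0 : 0 <= dl.
Hypothesis dlP : forall x y z : X,
  Num.min (gromov_product o x y) (gromov_product o y z) - dl
    <= gromov_product o x z.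
Hypothesis cpt : compact [set: gromov_closure o].

(** Balls are totally bounded: a ball that is not covered by finitely many
    balls of radius [e / 2] would carry an ultrafilter without limit point,
    although Gromov products are bounded on it. *)
Lemma separated_bounded (D e : R) : 0 < e ->
  exists K : nat, forall (T : finType) (x : T -> X),
    (forall t, mdist (x t) o <= D) ->
    (forall s t, s <> t -> e < mdist (x s) (x t)) -> (#|T| <= K)%N.
Proof.
move=> e0; pose P (A : set X) := ~ exists s : seq X,
  forall y, A y -> mdist y o <= D -> exists2 c, c \in s & mdist c y < e / 2.
have [[s sP]|PT] := pselect (exists s : seq X,
    forall y, mdist y o <= D -> exists2 c, c \in s & mdist c y < e / 2).
  exists (size s) => T x xD xe.
  have /choice[c cP] t : exists c, c \in s /\ mdist c (x t) < e / 2.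
    by have [c cs ct] := sP _ (xD t); exists c.
  have cs t : (index (c t) s < size s)%N by rewrite index_mem (cP t).1.
  rewrite -[leqRHS]card_ord; apply: (@leq_card _ _ (fun t => Ordinal (cs t))).
  move=> a b [] /(f_equal (nth o s)); rewrite !nth_index ?(cP _).1 // => ab.
  apply: contrapT => /xe; have := (cP a).2; have := (cP b).2; rewrite ab.
  have := metric_triangle (x a) (c b) (x b); rewrite (metric_sym (x a) (c b)).
  lra.
have [||||U [UU _ UP]] := @grill_ultrafilter _ P setT.
- move=> A B AB nA [s sP]; apply: nA; exists s => y /AB; exact: sP.
- move=> A B nAB; apply: contrapT => /not_orP[/contrapT[s sA] /contrapT[t tB]].
  apply: nAB; exists (s ++ t) => y [Ay|By] yD.
    by have [c cs cy] := sA y Ay yD; exists c; rewrite // mem_cat cs.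
  by have [c cs cy] := tB y By yD; exists c; rewrite // mem_cat cs orbT.
- by move=> [s sP]; apply: PT; exists s => y; exact: sP.
- by apply; exists [::].
have [[x xU]|/(_ (D + 1))[A /UP nA AD]] :=
  ultrafilter_alternative dl_ge0 dlP id cpt UU.
  case: (UP _ (xU (e / 2) _)); first by rewrite divr_gt0.
  by exists [:: x] => y /= xy _; exists x; rewrite ?inE.
by case: nA; exists [::] => y Ay yD; have := AD _ _ Ay Ay; rewrite gpxx; lra.
Qed.

End Compactness.

(** * Growing sets of isometries *)

Section Growing.
Local Open Scope ring_scope.
Variables (R : realType) (X : metricType R) (o : X).
Implicit Types (A B : set (X -> X)) (c e : R).

Definition separated_family e (T : finType) (f : T -> X -> X) :=
  forall s t, s <> t -> e < mdist (f s o) (f t o).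

(** Counting separated families instead of orbit points lying in a fixed
    separated set makes the notion stable under left translation by an
    isometry. A negative [c] only asks for unboundedness, so that the case of
    zero entropy needs no separate treatment. *)
Definition growing c e A : Prop :=
  exists2 c', c < c' & forall N, exists2 n, (N <= n)%N &
    exists (T : finType) (f : T -> X -> X),
      [/\ forall t, A (f t), separated_family e f,
          forall t, n%:R <= mdist (f t o) o < n.+1%:R &
          expR (c' * n%:R) <= #|T|%:R].

Lemma growing_sub c e A B : A `<=` B -> growing c e A -> growing c e B.
Proof.
move=> AB [c' cc' h]; exists c' => // N; have [n Nn [T [f [fA fe fn Tn]]]] := h N.
by exists n => //; exists T, f; split => // t; exact: AB.
Qed.

Lemma growing0 c e : ~ growing c e set0.
Proof.
move=> [c' _ /(_ 0%N)[n _ [T [f [f0 _ _]]]]]; rewrite leNgt.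
suff -> : #|T| = 0%N by rewrite expR_gt0.
by apply: eq_card0 => t; case: (f0 t).
Qed.

Lemma not_growing c c' e A : ~ growing c e A -> c < c' ->
  exists N, forall n, (N <= n)%N -> forall (T : finType) (f : T -> X -> X),
    (forall t, A (f t)) -> separated_family e f ->
    (forall t, n%:R <= mdist (f t o) o < n.+1%:R) -> #|T|%:R < expR (c' * n%:R).
Proof.
move=> nA cc'; apply: contrapT => nN; apply: nA; exists c' => // N.
apply: contrapT => nn; apply: nN; exists N => n Nn T f fA fe fn.
by rewrite ltNge; apply/negP => Tn; apply: nn; exists n => //; exists T, f.
Qed.

Lemma growingU c e A B :
  growing c e (A `|` B) -> growing c e A \/ growing c e B.
Proof.
move=> [c' cc' h]; apply: contrapT => /not_orP[nA nB].
(* Halving the family costs a factor 2, absorbed by a smaller rate. *)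
pose c1 := (c + c') / 2; have cc1 : c < c1 by rewrite /c1; lra.
have [NA hA] := not_growing nA cc1; have [NB hB] := not_growing nB cc1.
have d0 : 0 < c' - c1 by rewrite /c1; lra.
have [NC hC] := affine_le_expR 2 0 d0.
have [n] := h (maxn NA (maxn NB NC)).
rewrite !geq_max => /and3P[An Bn Cn] [T [f [fAB fe fn Tn]]].
pose TA := {t : T | `[< A (f t) >]}; pose TB := {t : T | ~~ `[< A (f t) >]}.
have TAB : #|T| = (#|{: TA}| + #|{: TB}|)%N by rewrite !card_sig cardC.
have := hA n An TA (fun t => f (val t)) _ _ (fun t => fn (val t)).
have := hB n Bn TB (fun t => f (val t)) _ _ (fun t => fn (val t)).
have injs (P : pred T) : separated_family e (fun t : {t | P t} => f (val t)).
  by move=> s t st; apply: fe => /val_inj.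
move=> /(_ _ (injs _)) hTB /(_ _ (injs _)) hTA.
have {}hTA := hTA (fun t => asboolP _ (valP t)).
have {}hTB : #|{: TB}|%:R < expR (c1 * n%:R).
  apply: hTB => -[t /= /asboolPn nAt]; by have [|] := fAB t.
have : 2 * expR (c1 * n%:R) <= expR (c' * n%:R).
  have -> : c' * n%:R = (c' - c1) * n%:R + c1 * n%:R by ring.
  by rewrite expRD ler_wpM2r ?expR_ge0 //; have := hC n Cn; lra.
by move: Tn; rewrite TAB natrD; lra.
Qed.

End Growing.

Section GrowingBalls.
Local Open Scope ring_scope.
Variables (R : realType) (X : metricType R) (o : X) (dl : R).
Hypothesis dl_ge0 : 0 <= dl.
Hypothesis dlP : forall x y z : X,
  Num.min (gromov_product o x y) (gromov_product o y z) - dl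
    <= gromov_product o x z.
Hypothesis cpt : compact [set: gromov_closure o].

(** For a non-negative rate, balls may replace annuli: small balls contain
    boundedly many members of a separated family, and a ball of radius [n]
    meets only linearly many annuli, none of larger radius. *)
Lemma growing_of_balls (c e : R) (A : set (X -> X)) : 0 <= c -> 0 < e ->
  (exists2 c', c < c' & forall N, exists2 n, (N <= n)%N &
    exists (T : finType) (f : T -> X -> X),
      [/\ forall t, A (f t), separated_family o e f,
          forall t, mdist (f t o) o <= n.+1%:R &
          expR (c' * n%:R) <= #|T|%:R]) ->
  growing o c e A.
Proof.
move=> c0 e0 [c' cc' h]; pose c1 := (c + c') / 2.
exists c1; first by rewrite /c1; lra.
move=> N; have [K KP] := separated_bounded dl_ge0 dlP cpt N%:R e0.
have d0 : 0 < c' - c1 by rewrite /c1; lra.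
have [M MP] := affine_le_expR (K%:R * expR c1 + 2 * expR c1 + 1) (expR c1) d0.
have [n Mn [T [f [fA fe fn Tn]]]] := h M.
have c1n : 0 <= c1 * n%:R by rewrite mulr_ge0 // /c1; lra.
(* [K] bounds the members in the ball of radius [N], and [n.+2] the number of
   annuli. *)
have {}Tn : K%:R + 1 + n.+2%:R * expR (c1 * n.+1%:R) <= #|T|%:R.
  apply: le_trans Tn; have -> : c' * n%:R = (c' - c1) * n%:R + c1 * n%:R by ring.
  rewrite expRD; apply: le_trans (ler_wpM2r (expR_ge0 _) (MP n Mn)).
  have -> : c1 * n.+1%:R = c1 + c1 * n%:R by rewrite -natr1; ring.
  have -> : n.+2%:R = n%:R + 2 :> R by rewrite -addn2 natrD.
  rewrite expRD; have := expR_ge1Dx (c1 * n%:R).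
  have : 1 <= expR c1 by rewrite -expR0 ler_expR /c1; lra.
  have : 0 <= K%:R :> R by [].
  move: (expR c1) (expR (c1 * n%:R)) K%:R => u v k k0 u1 v1.
  have {}v1 : 1 <= v by lra.
  have uv1 : 0 <= k * (u * v - 1) by rewrite mulr_ge0 // subr_ge0 mulr_ege1.
  by nra.
pose near t := `[< mdist (f t o) o <= N%:R >].
pose TN := {t : T | near t}; pose S := {t : T | ~~ near t}.
have fiS (P : pred T) : separated_family o e (fun t : {t | P t} => f (val t)).
  by move=> s t st; apply: fe => /val_inj.
have TNK : (#|{: TN}| <= K)%N.
  apply: (KP _ (fun t : TN => f (val t) o)) => [t|]; last exact: fiS.
  exact: asboolP _ (valP t).
have TNS : #|T| = (#|{: TN}| + #|{: S}|)%N by rewrite !card_sig cardC.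
have {}Tn : n.+2%:R * expR (c1 * n.+1%:R) < #|{: S}|%:R.
  have : #|{: TN}|%:R <= K%:R :> R by rewrite ler_nat.
  by move: Tn; rewrite TNS natrD; lra.
have S0 : (0 < #|{: S}|)%N.
  by rewrite -(ltr0n R); apply: le_lt_trans Tn; rewrite mulr_ge0 ?expR_ge0.
have lev (t : S) : (Num.truncn (mdist (f (val t) o) o) < n.+2)%N.
  by rewrite ltnS truncn_le_nat; apply: le_lt_trans (fn _) _; rewrite ltr_nat.
have [t0] := large_fiber (fun t => Ordinal (lev t)) S0.
set j := Num.truncn (mdist (f (val t0) o) o); rewrite card_ord => Sj.
have jP : j%:R <= mdist (f (val t0) o) o < j.+1%:R by exact: truncn_itv (mdist_ge0 _ _).
exists j.
  rewrite -ltnS -(ltr_nat R); case/andP: jP => _; apply: le_lt_trans.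
  by have /asboolPn/negP := valP t0; rewrite -ltNge => /ltW.
pose F := {t : S | Ordinal (lev t) == Ordinal (lev t0)}.
exists F, (fun t => f (val (val t))); split=> [t|s t st|t|].
- exact: fA.
- by apply: fe => /val_inj/val_inj.
- have jE : Num.truncn (mdist (f (val (val t)) o) o) = j by have /eqP[] := valP t.
  by have := truncn_itv (mdist_ge0 (f (val (val t)) o) o); rewrite jE.
rewrite card_sig; set q := #|_| in Sj *.
have -> : #|[pred x | Ordinal (lev x) == Ordinal (lev t0)]| = q.
  by rewrite /q; apply: eq_card => t; rewrite !inE.
have jn : (j <= n.+1)%N by rewrite -ltnS; exact: lev.
apply: (@le_trans _ _ (expR (c1 * n.+1%:R))).
  by rewrite ler_expR ler_wpM2l ?ler_nat // /c1; lra.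
rewrite -(ler_pM2l (ltr0Sn R n.+1)); apply: le_trans (ltW Tn) _.
by rewrite -natrM ler_nat mulnC.
Qed.

End GrowingBalls.

(** * Critical exponents through finite families *)

Section CriticalExponent.
Local Open Scope ring_scope.
Variables (R : realType).

Lemma le_lne_counting (V : choiceType) (A : set V) (r : R) :
  (r%:E <= lne (counting A))%E <-> exists (T : finType) (x : T -> V),
    [/\ injective x, forall t, A (x t) & expR r <= #|T|%:R].
Proof.
have fsetE (B : {fset V}) : [set` B] `<=` A -> expR r <= #|` B|%:R ->
    exists (T : finType) (x : T -> V),
    [/\ injective x, forall t, A (x t) & expR r <= #|T|%:R].
  move=> BA rB; exists B, val; split; first exact: val_inj.
    by move=> t; apply: BA; exact: valP.
  by rewrite -cardfE.
rewrite /counting; case: asboolP => [Af|Ai]; split.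
- have [->|n0] := eqVneq #|` fset_set A| 0%N; first by rewrite /= lexx leeNy_eq.
  have n1 : 0 < #|` fset_set A|%:R :> R by rewrite ltr0n lt0n.
  rewrite lne_EFin // lee_fin => rA; apply: (fsetE (fset_set A)).
    by move=> x /=; rewrite in_fset_set // inE.
  by rewrite -(lnK n1) ler_expR.
- move=> [T [x [xi xA rT]]].
  have Tn : (#|T| <= #|` fset_set A|)%N.
    rewrite cardE -(size_map x); apply: uniq_leq_size.
      by rewrite map_inj_uniq ?enum_uniq.
    by move=> _ /mapP[t _ ->]; rewrite in_fset_set // inE; exact: xA.
  have rA : expR r <= #|` fset_set A|%:R by apply: le_trans rT _; rewrite ler_nat.
  have n1 : 0 < #|` fset_set A|%:R :> R by apply: lt_le_trans rA; exact: expR_gt0.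
  by rewrite lne_EFin // lee_fin -ler_expR lnK.
- move=> _; have [B BA nB] := infinite_set_fset (Num.truncn (expR r)).+1 Ai.
  apply: (fsetE B BA); have /andP[_ /ltW h] := truncn_itv (expR_ge0 r).
  by apply: le_trans h _; rewrite ler_nat.
- by move=> _; rewrite /= leey.
Qed.

Variables (X : metricType R) (o : X).
Implicit Types (P : set X) (c : R).

Definition ball_family P (n : nat) (T : finType) (x : T -> X) :=
  injective x /\ forall t, P (x t) /\ mdist (x t) o < n%:R.

Lemma counting_rateP P c n : (0 < n)%N ->
  (c%:E <= ((n%:R : R)^-1)%:E * lne (counting (ball o n%:R `&` P)))%E <->
  exists (T : finType) (x : T -> X),
    ball_family P n x /\ expR (c * n%:R) <= #|T|%:R.
Proof.
move=> n0; have n0R : 0 < n%:R :> R by rewrite ltr0n.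
rewrite lee_pdivlMl // -EFinM mulrC; split.
  move=> /le_lne_counting[T [x [xi xA cT]]]; exists T, x; split => //.
  by split => // t; have [] := xA t; rewrite ballEmdist /= metric_sym.
move=> [T [x [[xi xA] cT]]]; apply/le_lne_counting; exists T, x; split => // t.
by have [Px xn] := xA t; split => //; rewrite ballEmdist /= metric_sym.
Qed.

Lemma crit_exponent_set_ge P c :
  (forall N, exists2 n, (N < n)%N & exists (T : finType) (x : T -> X),
    ball_family P n x /\ expR (c * n%:R) <= #|T|%:R) ->
  (c%:E <= crit_exponent_set o P)%E.
Proof.
move=> h; apply: le_ereal_inf_tmp => _ [V [N _ NV] <-].
have [n Nn] := h N; move/(counting_rateP P c (leq_trans (ltn0Sn _) Nn)).
move=> /le_trans; apply; apply: ereal_sup_ubound; exists n => //.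
by apply: NV; exact: ltnW.
Qed.

Lemma crit_exponent_set_gt P c : (c%:E < crit_exponent_set o P)%E ->
  exists2 c', c < c' & forall N, exists2 n, (N < n)%N &
    exists (T : finType) (x : T -> X),
      ball_family P n x /\ expR (c' * n%:R) <= #|T|%:R.
Proof.
move=> cP.
have [c' cc' c'P] : exists2 c', c < c' & (c'%:E < crit_exponent_set o P)%E.
  case: (crit_exponent_set o P) cP => [r|_|//]; last first.
    by exists (c + 1); [lra|exact: ltry].
  by rewrite lte_fin => cr; exists ((c + r) / 2); rewrite ?lte_fin; lra.
exists c' => // N; have nbN : [set k | (N < k)%N] \in \oo by rewrite inE; exists N.+1.
have := lt_le_trans c'P (ereal_inf_lbound (ex_intro2 _ _ _ (set_mem nbN) erefl)).
move=> /ereal_sup_gt[_ [n /= Nn <-]] /ltW c'n; exists n => //.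
by apply/(counting_rateP P c' (leq_trans (ltn0Sn _) Nn)).
Qed.

End CriticalExponent.

(** * The upper bound *)

Section PingPong.
Variables (X : Type) (I : eqType) (g : I -> X -> X) (Xp : set X).
Hypothesis g_inj : forall i, injective (g i).
Hypothesis g_sub : forall i, g i @` Xp `<=` Xp.
Hypothesis g_disj : forall i j, i != j -> g i @` Xp `&` g j @` Xp = set0.

Lemma word_map_sub w x : Xp x -> Xp (word_map g w x).
Proof. by elim: w => //= i w IH /IH Xw; apply: g_sub; exists (word_map g w x). Qed.

(** The fundamental domain of the ping-pong table has pairwise disjoint images
    under distinct words, the empty word included. *)
Lemma word_map_inj w w' x x' :
  (Xp `\` \bigcup_i (g i @` Xp)) x -> (Xp `\` \bigcup_i (g i @` Xp)) x' ->
  word_map g w x = word_map g w' x' -> w = w'.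
Proof.
move=> Yx Yx'; elim: w w' => [|i w IH] [|j w'] //=.
- move=> xE; case: Yx.2; exists j => //; rewrite xE.
  by exists (word_map g w' x') => //; apply: word_map_sub; case: Yx'.
- move=> xE; case: Yx'.2; exists i => //; rewrite -xE.
  by exists (word_map g w x) => //; apply: word_map_sub; case: Yx.
have [<- /g_inj/IH ->//|ij gE] := eqVneq i j.
have : (g i @` Xp `&` g j @` Xp) (g i (word_map g w x)).
  split; first by exists (word_map g w x) => //; apply: word_map_sub; case: Yx.
  by rewrite gE; exists (word_map g w' x') => //; apply: word_map_sub; case: Yx'.
by rewrite g_disj.
Qed.

End PingPong.

Section UpperBound.
Local Open Scope ring_scope.
Variables (R : realType) (X : metricType R) (o : X) (dl : R).
Hypothesis dl_ge0 : 0 <= dl.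
Hypothesis dlP : forall x y z : X,
  Num.min (gromov_product o x y) (gromov_product o y z) - dl
    <= gromov_product o x z.
Hypothesis cpt : compact [set: gromov_closure o].
Implicit Types (G : set (X -> X)).

Lemma gromov_disjointI (A B : set X) : gromov_disjoint o A B -> A `&` B = set0.
Proof.
by move=> [AB _]; apply: subsetI_eq0 AB; exact: subset_closure.
Qed.

(** Orbits of the base point need not be separated, but those of a point of
    the fundamental domain are. *)
Lemma schottky_separated G : schottky_semigroup o G ->
  exists x, exists2 e : R, 0 < e &
    forall f f', G f -> G f' -> f <> f' -> e < mdist (f x) (f' x).
Proof.
move=> [[Giso _] [Xp [n [g [n0 GE gd gXp [x xY]]]]]].
have [e /= e0] := (nbhs_ballP _ _).1 xY; rewrite ballEmdist => eY.
have gG i : G (g i) by rewrite GE; exists [:: i].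
have ginj i : injective (g i) by have [/bij_inj + _] := Giso _ (gG i).
have gsub i : g i @` Xp `<=` Xp.
  move=> y gy; apply: contrapT => nXy.
  by have := gromov_disjointI (gXp i); rewrite -subset0 => /(_ y); apply.
exists x; exists (e / 2); first by rewrite divr_gt0.
move=> f f' Gf Gf' ff'; rewrite ltNge; apply/negP => fe; apply: ff'.
have [[[f1 _ f1K] fd] [_ f'd]] := (Giso _ Gf, Giso _ Gf').
have Yx : (Xp `\` \bigcup_i (g i @` Xp)) x by apply: eY; rewrite /= mdistxx.
have Yy : (Xp `\` \bigcup_i (g i @` Xp)) (f1 (f' x)).
  by apply: eY; rewrite /= -fd f1K; apply: le_lt_trans fe _; lra.
move: Gf Gf' f1K Yy; rewrite GE => -[w _ <-] [w' _ <-] f1K Yy.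
congr word_map; apply: (word_map_inj ginj gsub _ Yy Yx (f1K _)) => i j.
by move=> /gd/gromov_disjointI.
Qed.

Lemma ereal_le_real (a b : \bar R) :
  (forall c : R, (c%:E < a)%E -> (c%:E <= b)%E) -> (a <= b)%E.
Proof.
move=> ab; case: leP => // ba; exfalso.
have [c cb ca] : exists2 c : R, (b < c%:E)%E & (c%:E < a)%E.
  move: a b ba {ab} => [a| |] [b| |] //=.
  - by rewrite lte_fin => ba; exists ((a + b) / 2); rewrite lte_fin; lra.
  - by move=> _; exists (a - 1); rewrite ?ltNyr // lte_fin; lra.
  - by move=> _; exists (b + 1); rewrite ?ltry // lte_fin; lra.
  - by move=> _; exists 0; rewrite ?ltNyr ?ltry.
by have := ab c ca; rewrite leNgt cb.
Qed.

(** A maximal 1-separated subset of the orbit has the same exponential growth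
    as the orbit, because translating back to the base point bounds the number
    of orbit points within distance 1 of any of its points. *)
Lemma schottky_exponent_le_entropy G G' : G' `<=` G ->
  schottky_semigroup o G' -> (crit_exponent o G' <= entropy o G)%E.
Proof.
move=> G'G G'S; have [Giso' _] := G'S.1.
have [x [e e0 xe]] := schottky_separated G'S.
pose P := orbit_set G' o.
pose far (S : set X) := forall a b, S a -> S b -> a <> b -> 1 < mdist a b.
have [|S [[SP Sfar] Smax]] := @Zorn_bigcup X (fun S => S `<=` P /\ far S).
  move=> F FP Ftot; split; first by move=> a [S /FP[SP _]]; exact: SP.
  move=> a b [S FS Sa] [S' FS' S'b].
  have [SS'|S'S] := Ftot _ _ FS FS'; first by apply: (FP _ FS').2 => //; exact: SS'.
  by apply: (FP _ FS).2 => //; exact: S'S.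
have net y : P y -> exists2 s, S s & mdist y s <= 1.
  move=> Py; apply: contrapT => ny.
  have yfar s : S s -> 1 < mdist y s.
    by move=> Ss; rewrite ltNge; apply/negP => ys; apply: ny; exists s.
  apply: (Smax (S `|` [set y])).
    split; first by move=> a Sa; left.
    by move=> /(_ y (or_intror erefl))/yfar; rewrite mdistxx ltr10.
  split; first by move=> a [/SP //|->].
  move=> a b [Sa|->] [Sb|->] ab //; first exact: Sfar.
    by rewrite metric_sym; exact: yfar.
  exact: yfar.
have [K KP] := separated_bounded dl_ge0 dlP cpt (mdist x o + 1) e0.
apply: ereal_le_real => c /crit_exponent_set_gt[c' cc' c'P].
have SG : S `<=` orbit_set G o by move=> s /SP[f /G'G Gf <-]; exists f.
rewrite /entropy /entropy_set; case: asboolP => [G0|_].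
  have [n _ [T [y [[_ yP] Ty]]]] := c'P 0%N.
  have [t _] : exists t : T, true.
    apply: contrapT => nt; move: Ty; suff -> : #|T| = 0%N by rewrite leNgt expR_gt0.
    by apply: eq_card0 => t; case: nt; exists t.
  by have [s /SG] := net _ (yP t).1; rewrite G0.
apply: (@le_trans _ _ (crit_exponent_set o (orbit_set G o `&` S))); last first.
  by apply: ereal_sup_ubound; exists S => //; exists 1.
apply: crit_exponent_set_ge => N.
have d0 : 0 < c' - c by lra.
have [M MP] := affine_le_expR (K%:R * expR c) 0 d0.
have [n] := c'P (maxn M N); rewrite gtn_max => /andP[Mn Nn] [T [y [[yi yP] Ty]]].
exists n.+1; first exact: ltnW.
have /choice[s sP] t : exists s, S s /\ mdist (y t) s <= 1.
  by have [s] := net _ (yP t).1; exists s.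
have /choice[f fP] t : exists f, G' f /\ f o = y t.
  by have [f Gf <-] := (yP t).1; exists f.
have [|a b /eqP ->//|t|J Jind TJ] := @independent_subset T (fun a b => s a == s b) K.
- by move=> t; exact: eqxx.
- (* The members assigned to the same point are translated back to [o]. *)
  pose F := {a : T | s a == s t}.
  have -> : #|[set a | s t == s a]%SET| = #|{: F}|.
    by rewrite card_sig; apply: eq_card => a; rewrite !inE eq_sym.
  have [h [Gh ho]] : exists h, G' h /\ h o = s t.
    by have [h Gh <-] := SP _ (sP t).1; exists h.
  have [[h1 _ h1K] hd] := Giso' _ Gh.
  apply: (KP F (fun a => h1 (f (val a) x))) => [a|a b ab].
    rewrite -hd h1K ho; have := metric_triangle (f (val a) x) (f (val a) o) (s t).
    rewrite (Giso' _ (fP _).1).2 (fP _).2; have := (sP (val a)).2.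
    by rewrite (eqP (valP a)); lra.
  rewrite -hd !h1K; apply: xe; [exact: (fP _).1|exact: (fP _).1|].
  move=> fab; apply: ab; apply: val_inj; apply: yi.
  by rewrite -(fP (val a)).2 fab (fP _).2.
exists {t : T | t \in J}, (fun t => s (val t)); split; first split.
- move=> a b sab; apply: val_inj; apply: contrapT => /eqP ab.
  by have := Jind _ _ (valP a) (valP b) ab; rewrite sab eqxx.
- move=> t; have [St yt] := sP (val t); split; first by split => //; exact: SG.
  have := metric_triangle (s (val t)) (y (val t)) o.
  rewrite (metric_sym (s (val t)) (y (val t))).
  by have := (yP (val t)).2; rewrite -natr1; lra.
have KJ : expR (c' * n%:R) <= K%:R * #|J|%:R.
  by apply: le_trans Ty _; rewrite -natrM ler_nat.
have K0 : 0 < K%:R :> R.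
  rewrite ltr0n lt0n; apply/eqP => K0; move: KJ.
  by rewrite K0 mul0r leNgt expR_gt0.
rewrite card_sig (_ : #|[pred t | t \in J]| = #|J|); last exact: eq_card.
rewrite -(ler_pM2l K0); apply: le_trans KJ.
have -> : c * n.+1%:R = c + c * n%:R by rewrite -natr1; ring.
have -> : c' * n%:R = (c' - c) * n%:R + c * n%:R by ring.
rewrite !expRD mulrA ler_wpM2r ?expR_ge0 //.
by have := MP n (ltnW Mn); lra.
Qed.

End UpperBound.

(** * Schottky semigroups from ping-pong families *)

Section SchottkyConstruction.
Local Open Scope ring_scope.
Variables (R : realType) (X : metricType R) (o : X) (dl : R).
Hypothesis dl_ge0 : 0 <= dl.
Hypothesis dlP : forall x y z : X,
  Num.min (gromov_product o x y) (gromov_product o y z) - dl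
    <= gromov_product o x z.
Local Notation gp := (gromov_product o).

(** The contrapositive use of hyperbolicity: a point [y] close to [z] is as far
    from [x] as [z] is. *)
Lemma gp_far s x y z : gp x z <= s -> s + dl < gp y z -> gp x y <= s + dl.
Proof.
move=> xz yz; have := dlP x y z; rewrite minEle.
case: ifP => _; lra.
Qed.

Lemma closure_gp_le (A : set X) q s z :
  (forall a, A a -> gp a q <= s) -> closure A z -> gp z q <= s.
Proof.
move=> As Az; rewrite leNgt; apply/negP => sz.
have e0 : 0 < gp z q - s by lra.
have [a [Aa]] := Az _ (nbhsx_ballx z _ e0).
rewrite ballEmdist /= => za; have := As a Aa; have := gp_lipl o z a q; lra.
Qed.

Lemma closure_gp_ge (A : set X) q s z :
  (forall a, A a -> s <= gp a q) -> closure A z -> s <= gp z q.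
Proof.
move=> As Az; rewrite leNgt; apply/negP => sz.
have e0 : 0 < s - gp z q by lra.
have [a [Aa]] := Az _ (nbhsx_ballx z _ e0).
rewrite ballEmdist /= metric_sym => za.
by have := As a Aa; have := gp_lipl o a z q; lra.
Qed.

Lemma gromov_disjoint_of (A B : set X) q s t C : s < t ->
  (forall a, A a -> gp a q <= s) -> (forall b, B b -> t <= gp b q) ->
  (forall a b, A a -> B b -> gp a b <= C) -> gromov_disjoint o A B.
Proof.
move=> st As Bt AB; split.
  rewrite -subset0 => z [Az Bz].
  by have := closure_gp_le As Az; have := closure_gp_ge Bt Bz; lra.
have C0 : 0 <= Num.max C 0 by rewrite le_max lexx orbT.
exists (Num.max C 0 + 1); first by lra.
apply: (@le_lt_trans _ _ (Num.max C 0)%:E); last by rewrite lte_fin; lra.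
apply: ge_ereal_sup => _ [[a b] [/= Aa Bb] <-].
by rewrite lee_fin le_max AB.
Qed.

Section Generators.
Variables (n m : nat) (g : 'I_n -> X -> X) (C L : R).
Let C1 := C + 2 * dl + 1.
Hypothesis n_gt0 : (0 < n)%N.
Hypothesis g_iso : forall i, is_isometry (g i).
Hypothesis C_ge0 : 0 <= C.
Hypothesis repelling : forall i j,
  C1 + dl < gp (base_preimage o (g i)) (base_preimage o (g j)).
Hypothesis attracting : forall i j, gp (g i o) (base_preimage o (g j)) <= C.
Hypothesis g_len : forall i, L <= mdist (g i o) o < m%:R.
Hypothesis L_large : C + C1 + 2 * dl + 1 < L.
Hypothesis g_sep : forall i j, i != j ->
  2 * (m%:R - L + C1 + 3 * dl) < mdist (g i o) (g j o).

Let p := base_preimage o (g (Ordinal n_gt0)).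
Let Xp : set X := [set x | gp x p <= C1].

Let gp_image i x : Xp x -> L - C1 - dl <= gp (g i x) (g i o).
Proof.
move=> Xx; rewrite gpC gp_shadow // gpC.
have /andP[+ _] := g_len i.
by have := gp_far Xx (repelling i (Ordinal n_gt0)); lra.
Qed.

Let gp_image_p i x : Xp x -> gp (g i x) p <= C + dl.
Proof.
move=> Xx; rewrite gpC; apply: gp_far (_ : gp p (g i o) <= C) _.
  by rewrite gpC; exact: attracting.
by have := gp_image i Xx; have := L_large; have := dl_ge0; lra.
Qed.

Let gp_ij i j : i != j -> gp (g i o) (g j o) + 2 * dl < L - C1 - dl.
Proof.
move=> /g_sep; rewrite /gromov_product.
by have /andP[_ +] := g_len i; have /andP[_ +] := g_len j; lra.
Qed.

Let gp_cross i j x : i != j -> Xp x ->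
  gp (g j x) (g i o) <= gp (g i o) (g j o) + dl.
Proof.
move=> ij Xx; rewrite gpC; apply: gp_far (lexx _) _.
by have := gp_image j Xx; have := gp_ij ij; have := dl_ge0; lra.
Qed.

Let disj i j : i != j -> gromov_disjoint o (g i @` Xp) (g j @` Xp).
Proof.
move=> ij; have ji : j != i by rewrite eq_sym.
apply: (@gromov_disjoint_of _ _ (g j o) (gp (g j o) (g i o) + dl) (L - C1 - dl)
  (gp (g j o) (g i o) + dl + dl)).
- by have := gp_ij ji; have := dl_ge0; lra.
- by move=> _ [x Xx <-]; exact: gp_cross.
- by move=> _ [x Xx <-]; exact: gp_image.
move=> _ _ [x Xx <-] [y Xy <-]; apply: gp_far (gp_cross ji Xx) _.
by have := gp_image j Xy; have := gp_ij ji; lra.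
Qed.

Let disjC i : gromov_disjoint o (g i @` Xp) (~` Xp).
Proof.
have C1p y : (~` Xp) y -> C1 < gp y p by move=> /= /negP; rewrite -ltNge.
apply: (@gromov_disjoint_of _ _ p (C + dl) C1 (C + dl + dl)).
- by rewrite /C1; have := dl_ge0; lra.
- by move=> _ [x Xx <-]; exact: gp_image_p.
- by move=> y /C1p/ltW.
move=> _ y [x Xx <-] /C1p yp; apply: gp_far (gp_image_p i Xx) _.
by rewrite /C1 in yp; lra.
Qed.

Let g_sub i : g i @` Xp `<=` Xp.
Proof.
move=> y gy; apply: contrapT => nXy.
by have := gromov_disjointI (disjC i); rewrite -subset0 => /(_ y); apply.
Qed.

Let ball_fundamental y :
  mdist o y < 1 -> (Xp `\` \bigcup_i (g i @` Xp)) y.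
Proof.
rewrite metric_sym => oy; split.
  rewrite /Xp /=; have := gp_le o y p; have := dl_ge0; have := C_ge0.
  by rewrite /C1; lra.
move=> [i _ [x Xx xy]]; have := gp_image i Xx; rewrite xy.
by have := gp_le o y (g i o); have := L_large; have := dl_ge0; have := C_ge0; lra.
Qed.

Let word_len w : w != [::] -> mdist (word_map g w o) o < (size w * m)%:R.
Proof.
suff len v : mdist (word_map g v o) o <= (size v * m)%:R /\
    (v != [::] -> mdist (word_map g v o) o < (size v * m)%:R).
  by apply: (len w).2.
elim: v => [|i v [IH _]] /=; first by rewrite mdistxx mul0n.
suff h : mdist (g i (word_map g v o)) o < ((size v).+1 * m)%:R.
  by split => [|_]; rewrite ?ltW.
have := metric_triangle (g i (word_map g v o)) (g i o) o.
have /andP[_ +] := g_len i; rewrite (g_iso i).2 mulSn natrD; lra.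
Qed.

(** The set [X_+] consists of the points whose product with one repelling point
    [p] is at most [C1]. Its image under [g i] lies in the shadow of [g i o] at
    depth [L - C1 - dl], hence far from [p]. The points [g i o] and [g j o] have
    almost the same norm and are far apart, so their product is smaller than
    this depth, and the two images are Gromov-disjoint. The margin [2 * dl + 1]
    in [C1] separates the images from the complement of [X_+]. *)
Lemma ping_pong (G : set (X -> X)) : isometry_semigroup G ->
  (forall i, G (g i)) ->
  exists G', [/\ G' `<=` G, schottky_semigroup o G' &
    forall c : R, expR (c * m%:R) <= n%:R -> (c%:E <= crit_exponent o G')%E].
Proof.
move=> [Giso Gcomp] gG; exists (generated_semigroup g).
have wG w : w != [::] -> G (word_map g w).
  elim: w => // i [_ _|j w IH _]; first exact: gG.
  by apply: Gcomp; [exact: gG|exact: IH].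
have genG : generated_semigroup g `<=` G by move=> _ [w /wG Gw <-].
have word_cat v w : word_map g (v ++ w) = word_map g v \o word_map g w.
  by elim: v => //= i v ->.
split => //.
- split; first split; first by move=> f /genG /Giso.
    move=> _ _ [v v0 <-] [w w0 <-]; exists (v ++ w); last exact: word_cat.
    by move: v0; case: v.
  exists Xp, n, g; split => //; exists o; apply/nbhs_ballP; exists 1 => //=.
  by rewrite ballEmdist; exact: ball_fundamental.
move=> c cn; apply: crit_exponent_set_ge => N.
have m0 : (0 < m)%N.
  have /andP[_ +] := g_len (Ordinal n_gt0); rewrite -(ltr0n R).
  by apply: le_lt_trans; exact: mdist_ge0.
exists (N.+1 * m)%N; first exact: leq_pmulr.
exists (N.+1.-tuple 'I_n : finType), (fun w : N.+1.-tuple 'I_n => word_map g w o).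
split; first split.
- move=> v w vw; apply: val_inj.
  have Yo : (Xp `\` \bigcup_i (g i @` Xp)) o.
    by apply: ball_fundamental; rewrite mdistxx.
  apply: (word_map_inj _ g_sub _ Yo Yo vw) => [i|i j /disj/gromov_disjointI //].
  by have [/bij_inj] := g_iso i.
- move=> w; have w0 : tval w != [::] by rewrite -size_eq0 size_tuple.
  split; last by have := word_len w0; rewrite size_tuple.
  by exists (word_map g w) => //; exists w.
have -> : c * (N.+1 * m)%:R = N.+1%:R * (c * m%:R) by rewrite natrM mulrCA.
rewrite card_tuple card_ord natrX.
by rewrite expRM_natl; apply: lerXn2r => //; rewrite nnegrE ?expR_ge0 ?ler0n.
Qed.

End Generators.

End SchottkyConstruction.

(** * Ping-pong along an ultrafilter *)

Section LowerBound.
Local Open Scope ring_scope.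
Variables (R : realType) (X : metricType R) (o : X) (dl : R).
Hypothesis dl_ge0 : 0 <= dl.
Hypothesis dlP : forall x y z : X,
  Num.min (gromov_product o x y) (gromov_product o y z) - dl
    <= gromov_product o x z.
Hypothesis cpt : compact [set: gromov_closure o].
Local Notation gp := (gromov_product o).
Local Notation bp := (base_preimage o).
Variables (G : set (X -> X)) (c e : R).
Hypothesis G_semi : isometry_semigroup G.
Hypothesis e_gt0 : 0 < e.
Let G_iso f : G f -> is_isometry f. Proof. exact: G_semi.1. Qed.

Lemma growing_unbounded A N :
  growing o c e A -> exists2 f, A f & N%:R <= mdist (f o) o.
Proof.
move=> [c' _ /(_ N)[n Nn [T [f [fA _ fn Tn]]]]].
have [t _] : exists t : T, true.
  apply: contrapT => nt; move: Tn; suff -> : #|T| = 0%N by rewrite leNgt expR_gt0.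
  by apply: eq_card0 => t; case: nt; exists t.
exists (f t) => //; have /andP[+ _] := fn t; apply: le_trans; by rewrite ler_nat.
Qed.

Section Deep.
Variables (U : set_system (X -> X)).
Hypothesis UU : UltraFilter U.
Hypothesis UG : U G.
Hypothesis U_growing : forall A, U A -> growing o c e A.

(** Applied below to the orbit points and to the preimages of the base point,
    this provides the attracting and the repelling limit point of [U]. *)
Lemma ultra_deep (F : (X -> X) -> X) :
  (forall f, G f -> mdist (F f) o = mdist (f o) o) -> forall r,
  exists2 A, U A & forall a b, A a -> A b -> r <= gp (F a) (F b).
Proof.
move=> FE; have [[x xU]|//] := ultrafilter_alternative dl_ge0 dlP F cpt UU.
have UA : U (G `&` [set f | mdist x (F f) < 1]) by apply: filterI => //; exact: xU.
have [f [Gf /= xf] fN] :=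
  growing_unbounded (Num.truncn (mdist x o + 1)).+1 (U_growing UA).
have xo : 0 <= mdist x o + 1 by rewrite addr_ge0 ?mdist_ge0.
have /andP[_ h] := truncn_itv xo.
rewrite -FE // in fN; exfalso.
by have := metric_triangle (F f) x o; rewrite (metric_sym (F f) x); lra.
Qed.

(** If [h] moves the attracting limit point of [U] away from its repelling
    limit point, then the isometries [h \o a], for [a] in a deep set of [U],
    play ping-pong. *)
Lemma schottky_of_ultrafilter (h : X -> X) (r : R) :
  is_isometry h -> (forall f, G f -> G (h \o f)) ->
  (forall A, U A -> exists a b, [/\ A a, A b & gp (h (a o)) (bp b) < r]) ->
  exists G', [/\ G' `<=` G, schottky_semigroup o G' &
    (c%:E <= crit_exponent o G')%E].
Proof.
move=> h_iso hG hr; have dl0 := dl_ge0.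
pose H := mdist (h o) o; have H0 : 0 <= H by exact: mdist_ge0.
pose r1 := Num.max r 0; have r10 : 0 <= r1 by rewrite le_max lexx orbT.
pose C := r1 + 2 * dl + H; have C0 : 0 <= C by rewrite /C; lra.
pose C1 := C + 2 * dl + 1.
(* The depth [R0] makes up for the displacement [H] of the base point by [h],
   twice in the repelling hypothesis of [ping_pong]. *)
pose R0 := 2 * H + C1 + C + 2 * dl + 1.
have [A1 UA1 A1P] := ultra_deep (fun f Gf => erefl : mdist (f o) o = _) R0.
have [A2 UA2 A2P] := ultra_deep (fun f Gf => mdist_base_preimage o (G_iso Gf)) R0.
pose A := G `&` (A1 `&` A2).
have UA : U A by apply: filterI => //; exact: filterI.
have A_attr a b : A a -> A b -> gp (h (a o)) (bp b) <= r1 + 2 * dl.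
  move=> [_ [A1a _]] [_ [_ A2b]].
  have [a0 [b0 [[_ [A1a0 _]] [_ [_ A2b0]] ab0]]] := hr A UA.
  have h1 : gp (h (a0 o)) (bp b0) <= r1 by rewrite /r1 le_max (ltW ab0).
  have h2 : gp (bp b0) (h (a o)) <= r1 + dl.
    apply: (gp_far dlP) (_ : gp (bp b0) (h (a0 o)) <= r1) _; first by rewrite gpC.
    have := gp_isometry_ge o h_iso (a o) (a0 o); have := A1P _ _ A1a A1a0.
    by rewrite -/H /R0 /C1 /C; lra.
  have := A2P _ _ A2b A2b0; rewrite gpC in h2; move=> h3.
  have h4 : r1 + dl + dl < gp (bp b) (bp b0) by move: h3; rewrite /R0 /C1 /C; lra.
  by have := gp_far dlP h2 h4; lra.
have hA_bp a : A a -> mdist (bp (h \o a)) (bp a) = H.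
  by move=> [Ga _]; exact: base_preimage_comp h_iso (G_iso Ga).
pose b := (Num.truncn H).+1.
have Hb : H < b%:R by have /andP[] := truncn_itv H0.
(* The norms of the [h \o f] lie in a window of width [2 * b + 1]. *)
pose D := 2 * (2 * b%:R + 1 + C1 + 3 * dl).
have [K KP] := separated_bounded dl_ge0 dlP cpt D e_gt0.
have [c' cc' grA] := U_growing UA.
have d0 : 0 < c' - c by lra.
have [M MP] := affine_le_expR (K%:R * expR (c * b.+1%:R)) 0 d0.
have B0 : 0 <= C + C1 + 2 * dl + 1 + b%:R by rewrite /C1; lra.
pose N := (Num.truncn (C + C1 + 2 * dl + 1 + b%:R)%R).+1.
have [n] := grA (maxn M N); rewrite geq_max => /andP[Mn Nn] [T [f [fA fe fn Tn]]].
have nB : C + C1 + 2 * dl + 1 + b%:R < n%:R.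
  have /andP[_ hN] := truncn_itv B0; apply: lt_le_trans hN _.
  by rewrite ler_nat.
have [|s t|t|J Jind TJ] :=
  @independent_subset T (fun s t => mdist (f s o) (f t o) <= D) K.
- move=> t; rewrite mdistxx /D /C1; have := ler0n R b; lra.
- by rewrite metric_sym.
- have [[f1 _ f1K] fd] := G_iso (fA t).1.
  pose F := {s : T | mdist (f t o) (f s o) <= D}.
  have -> : #|[set s | (mdist (f t o) (f s o) <= D)%R]%SET| = #|{: F}|.
    by rewrite card_sig; apply: eq_card => s; rewrite !inE.
  apply: (KP F (fun s => f1 (f (val s) o))) => [s|s s' ss'].
    by rewrite -fd f1K metric_sym; exact: (valP s).
  by rewrite -fd !f1K; apply: fe => /val_inj.
have KJ : expR (c' * n%:R) <= K%:R * #|J|%:R.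
  by apply: le_trans Tn _; rewrite -natrM ler_nat.
have KJ0 : (0 < K * #|J|)%N.
  by rewrite -(ltr0n R) natrM; apply: lt_le_trans KJ; exact: expR_gt0.
move: KJ0; rewrite muln_gt0 => /andP[K0 J0].
have fA' (i : 'I_#|J|) : A (f (enum_val i)) by exact: fA.
have hf_len (i : 'I_#|J|) :
    n%:R - b%:R <= mdist (h (f (enum_val i) o)) o < (n + b.+1)%:R.
  have /andP[l1 l2] := fn (enum_val i); rewrite natrD -natr1; apply/andP.
  move: l2; rewrite -natr1 => l2.
  have := metric_triangle (h (f (enum_val i) o)) (h o) o; rewrite h_iso.2 -/H.
  have := metric_triangle (h (f (enum_val i) o)) o (h o).
  rewrite h_iso.2 (metric_sym o) -/H.
  by lra.
have [|||||||G' [G'G G'S G'c]] := @ping_pong _ X o dl dl_ge0 dlP #|J| (n + b.+1)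
  (fun i => h \o f (enum_val i)) C (n%:R - b%:R) J0 _ C0 _ _ _ _ _ G G_semi.
- by move=> i; apply: isometry_comp h_iso (G_iso (fA' i).1).
- move=> i j; have := A2P _ _ (fA' i).2.2 (fA' j).2.2.
  have := gp_lipl o (bp (f (enum_val i))) (bp (h \o f (enum_val i)))
    (bp (f (enum_val j))).
  have := gp_lipr o (bp (h \o f (enum_val i))) (bp (f (enum_val j)))
    (bp (h \o f (enum_val j))).
  rewrite !(metric_sym (bp (f _))) !hA_bp // /R0 /C1 /C; lra.
- move=> i j; have := A_attr _ _ (fA' i) (fA' j).
  have := gp_lipr o (h (f (enum_val i) o)) (bp (h \o f (enum_val j)))
    (bp (f (enum_val j))).
  by rewrite !hA_bp // /C /=; lra.
- exact: hf_len.
- by move: nB; rewrite /C1; lra.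
- move=> i j ij; have := Jind _ _ (enum_valP i) (enum_valP j).
  have -> : enum_val i != enum_val j by apply: contra ij => /eqP/enum_val_inj ->.
  move=> /(_ isT); rewrite -ltNge /= h_iso.2 /D /C1 natrD -natr1; lra.
- by move=> i; apply: hG; exact: (fA' i).1.
exists G'; split => //; apply: G'c.
have K0R : 0 < K%:R :> R by rewrite ltr0n.
rewrite -(ler_pM2l K0R); apply: le_trans KJ.
have -> : c * (n + b.+1)%:R = c * b.+1%:R + c * n%:R by rewrite natrD; ring.
have -> : c' * n%:R = (c' - c) * n%:R + c * n%:R by ring.
rewrite !expRD mulrA ler_wpM2r ?expR_ge0 //.
by have := MP n Mn; lra.
Qed.

End Deep.

End LowerBound.

(** * The case of a fixed limit point, and the lower bound *)

Section FixedPoint.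
Local Open Scope ring_scope.
Variables (R : realType) (X : metricType R) (o : X) (dl : R).
Hypothesis dl_ge0 : 0 <= dl.
Hypothesis dlP : forall x y z : X,
  Num.min (gromov_product o x y) (gromov_product o y z) - dl
    <= gromov_product o x z.
Hypothesis cpt : compact [set: gromov_closure o].
Local Notation gp := (gromov_product o).
Local Notation bp := (base_preimage o).
Variables (G : set (X -> X)).
Hypothesis G_semi : isometry_semigroup G.
Let G_iso f : G f -> is_isometry f. Proof. exact: G_semi.1. Qed.

Lemma growing_of_unbounded (c e : R) (A : set (X -> X)) : c < 0 ->
  (forall N : nat, exists2 f, A f & N%:R <= mdist (f o) o) -> growing o c e A.
Proof.
move=> c0 h; exists 0 => // N; have [f Af fN] := h N.
have f0 := mdist_ge0 (f o) o.
exists (Num.truncn (mdist (f o) o)); first by rewrite truncn_ge_nat.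
exists unit, (fun=> f); split => //; first by case; case.
  by move=> _; exact: truncn_itv.
by rewrite mul0r expR0 card_unit.
Qed.

Lemma gromov_convergent_norm (u : nat -> X) : gromov_convergent o u ->
  forall N M, exists2 i, (M <= i)%N & N%:R <= mdist (u i) o.
Proof.
move=> /gromov_equivP h N M; have [K KP] := h N%:R.
exists (maxn K M); first exact: leq_maxr.
by rewrite -gpxx; apply: KP; exact: leq_maxl.
Qed.

Lemma growing_of_entropy (c : R) :
  (forall N : nat, exists2 f, G f & N%:R <= mdist (f o) o) ->
  (c%:E < entropy o G)%E -> exists2 e : R, 0 < e & growing o c e G.
Proof.
move=> G_unb cG; have [c0|c0] := ltP c 0.
  by exists 1 => //; exact: growing_of_unbounded.
move: cG; rewrite /entropy /entropy_set; case: asboolP => _.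
  by rewrite lte_fin ltNge c0.
move=> /ereal_sup_gt[_ [S [e e0 Se] <-]] /crit_exponent_set_gt[c' cc' h].
exists e => //; apply: (growing_of_balls dl_ge0 dlP cpt) => //.
exists c' => // N; have [n Nn [T [x [[xi xP] Tx]]]] := h N.
exists n; first exact: ltnW.
have /choice[f fP] t : exists f, G f /\ f o = x t.
  by have [[[f Gf <-] _] _] := xP t; exists f.
exists T, f; split => //; first by move=> t; exact: (fP t).1.
  move=> s t st; rewrite (fP s).2 (fP t).2.
  by apply: Se; [exact: (xP s).1.2|exact: (xP t).1.2|move=> /xi].
move=> t; rewrite (fP t).2 ltW //; apply: lt_trans (xP t).2 _.
by rewrite ltr_nat.
Qed.

Section Contraction.
Variables (g : X -> X) (p : X) (C : R).
Hypothesis g_iso : is_isometry g.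
Hypothesis g_off : gp (g o) p <= C.
Hypothesis g_fix : C + dl < gp (g p) p.
Hypothesis g_long : 2 * C + 4 * dl + 1 <= mdist (g o) o.

(** The inverse of [g] moves the base point towards [p]; hence [g] brings back
    to the base point whatever lies in the direction of [p]. *)
Lemma repelling_contracts x :
  mdist (g o) o <= gp x p -> mdist (g x) o <= mdist x o - 1.
Proof.
move=> xp; have C0 : 0 <= C by apply: le_trans (gp_ge0 _ _ _) g_off.
have dl0 := dl_ge0; have := gp_far dlP g_off g_fix; rewrite gp_shadow // => h.
have h1 : mdist (g o) o - C - dl <= gp x p by lra.
have h2 : mdist (g o) o - C - dl <= gp p (bp g) by rewrite gpC; lra.
have h3 := gp_chain dlP h1 h2.
rewrite (mdist_isometry o g_iso); have := g_long; lra.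
Qed.

Lemma iterate_away n x : mdist x o < n.+1%:R -> exists2 k, (k <= n.+1)%N &
  mdist (iter k g x) o <= mdist x o /\ gp (iter k g x) p < mdist (g o) o.
Proof.
elim: n x => [|n IH] x xn;
  (have [xp|/repelling_contracts gx] := ltP (gp x p) (mdist (g o) o);
    first by exists 0%N).
  by have := mdist_ge0 (g x) o; lra.
have [|k kn [kx kp]] := IH (g x); first by rewrite -natr1 in xn; lra.
by exists k.+1 => //; rewrite iterSr; split => //; lra.
Qed.

End Contraction.

Lemma iter_semigroup g f k : G g -> G f -> G (fun x => iter k g (f x)).
Proof. by move=> Gg Gf; elim: k => //= k IH; exact: G_semi.2. Qed.

(** Each member of a growing family is composed with the power of [g] that moves
    it away from [p]. As there are only linearly many such powers, one of them
    serves a large part of the family, and a common power keeps that part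
    separated. *)
Lemma growing_away (c e : R) (g : X -> X) (p : X) (C : R) :
  0 <= c -> 0 < e -> G g -> gp (g o) p <= C -> C + dl < gp (g p) p ->
  2 * C + 4 * dl + 1 <= mdist (g o) o ->
  growing o c e G ->
  growing o c e (G `&` [set f | gp (f o) p <= mdist (g o) o]).
Proof.
move=> c0 e0 Gg g_off g_fix g_long [c' cc' h]; have g_iso := G_iso Gg.
apply: (growing_of_balls dl_ge0 dlP cpt) => //.
pose c1 := (c + c') / 2; exists c1; first by rewrite /c1; lra.
have d0 : 0 < c' - c1 by rewrite /c1; lra.
have [M MP] := affine_le_expR 2 1 d0.
move=> N; have [n] := h (maxn M N); rewrite geq_max => /andP[Mn Nn].
move=> [T [f [fG fe fn Tn]]]; exists n => //.
have /choice[k kP] t : exists k : 'I_n.+2,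
    mdist (iter k g (f t o)) o <= mdist (f t o) o /\
    gp (iter k g (f t o)) p < mdist (g o) o.
  have /andP[_ ftn] := fn t.
  have [k kn kP] := iterate_away g_iso g_off g_fix g_long ftn.
  by exists (Ordinal (kn : (k < n.+2)%N)).
have T0 : (0 < #|T|)%N by rewrite -(ltr0n R); apply: lt_le_trans Tn; exact: expR_gt0.
have [t0] := large_fiber k T0; rewrite card_ord; set q := #|_| => Tq.
pose F := {t : T | k t == k t0}.
have FE : #|{: F}| = q.
  by rewrite card_sig /q; apply: eq_card => t; rewrite !inE.
exists F, (fun t x => iter (k t0) g (f (val t) x)); split.
- move=> t; split; first exact: iter_semigroup.
  by have [_] := kP (val t); rewrite (eqP (valP t)) => /ltW.
- move=> s t st.
  have -> x y : mdist (iter (k t0) g x) (iter (k t0) g y) = mdist x y.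
    by elim: (nat_of_ord _) => //= j <-; exact: g_iso.2.
  by apply: fe => /val_inj.
- move=> t; have [+ _] := kP (val t); rewrite (eqP (valP t)) => /le_trans; apply.
  by have /andP[_ /ltW] := fn (val t).
have n2 : 0 < n.+2%:R :> R by rewrite ltr0n.
rewrite FE -(ler_pM2l n2); apply: (@le_trans _ _ (expR (c' * n%:R))); last first.
  by apply: le_trans Tn _; rewrite -natrM ler_nat mulnC.
have -> : c' * n%:R = (c' - c1) * n%:R + c1 * n%:R by ring.
rewrite expRD ler_wpM2r ?expR_ge0 //.
by have := MP n Mn; rewrite -addn2 natrD; lra.
Qed.

Section LimitPoint.
Variables (U : set_system (X -> X)) (c e : R).
Hypothesis UU : UltraFilter U.
Hypothesis UG : U G.
Hypothesis U_growing : forall A, U A -> growing o c e A.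
Let U_deep r : exists2 A, U A & forall a b, A a -> A b -> r <= gp (a o) (b o).
Proof.
exact: (ultra_deep dl_ge0 dlP cpt UU UG U_growing
  (fun f _ => erefl : mdist (f o) o = _)).
Qed.

Definition tends_to_limit (w : nat -> X) := forall r, exists2 A, U A &
  exists N, forall i a, (N <= i)%N -> A a -> r <= gp (w i) (a o).

Lemma tends_to_limit_equiv u v :
  tends_to_limit u -> tends_to_limit v -> gromov_equiv o u v.
Proof.
move=> ul vl; apply/gromov_equivP => r.
have [A UA [N NP]] := ul (r + dl); have [B UB [M MP]] := vl (r + dl).
have [a [Aa Ba]] := ultra_meet UU UA UB.
exists (maxn N M) => i j; rewrite !geq_max => /andP[Ni _] /andP[_ Mj].
have h1 := NP i a Ni Aa; have h2 := MP j a Mj Ba; rewrite gpC in h2.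
by have := gp_chain dlP h1 h2; lra.
Qed.

(** One small product with a deep point of [U] bounds all later products, by
    hyperbolicity. *)
Lemma not_tends_to_limit w : gromov_convergent o w -> ~ tends_to_limit w ->
  exists C A N, U A /\ forall i a, (N <= i)%N -> A a -> gp (w i) (a o) <= C.
Proof.
move=> /gromov_equivP wc nw.
have [r rP] : exists r, forall A, U A -> forall N,
    exists i a, [/\ (N <= i)%N, A a & gp (w i) (a o) < r].
  apply: contrapT => nr; apply: nw => r; apply: contrapT => nA; apply: nr.
  exists r => A UA N; apply: contrapT => nia; apply: nA; exists A => //; exists N.
  move=> i a Ni Aa; rewrite leNgt; apply/negP => ia; apply: nia.
  by exists i, a.
have dl0 := dl_ge0.
have [A UA AP] := U_deep (r + 2 * dl + 1); have [N NP] := wc (r + 2 * dl + 1).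
have [i0 [a0 [Ni0 Aa0 ia0]]] := rP A UA N.
exists (r + dl + dl), A, N; split => // i a Ni Aa.
have h1 : r + dl < gp (a o) (a0 o) by have := AP _ _ Aa Aa0; lra.
have h2 := gp_far dlP (ltW ia0) h1; rewrite gpC in h2.
have h3 : r + dl + dl < gp (w i) (w i0) by have := NP _ _ Ni Ni0; lra.
by rewrite gpC; have := gp_far dlP h2 h3.
Qed.

(** When [G] fixes the limit point of [U] although some orbit sequence [w]
    stays away from it, a member of that sequence repels from the fixed point;
    its powers turn a family with the growth of [G] into one that stays away
    from the fixed point. An ultrafilter on that family cannot have the same
    attracting and repelling limit point, as its members fix a further
    point. *)
Lemma schottky_of_fixed_point (w : nat -> X) :
  0 < e -> (forall i, orbit_set G o (w i)) ->
  gromov_convergent o w -> ~ tends_to_limit w ->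
  (forall h, G h -> forall r, exists2 A, U A &
    forall a, A a -> r <= gp (h (a o)) (a o)) ->
  exists G', [/\ G' `<=` G, schottky_semigroup o G' &
    (c%:E <= crit_exponent o G')%E].
Proof.
move=> e0 wG wc nw fixG; have dl0 := dl_ge0.
have [C [A0 [N0 [UA0 offC]]]] := not_tends_to_limit wc nw.
have [g [Gg g_long g_off]] : exists g, [/\ G g,
    2 * C + 4 * dl + 1 <= mdist (g o) o &
    forall a, A0 a -> gp (g o) (a o) <= C].
  have [i N0i iN] :=
    gromov_convergent_norm wc (Num.truncn `|2 * C + 4 * dl + 1|).+1 N0.
  have [g Gg gE] := wG i; exists g; rewrite gE; split => //; last first.
    by move=> a; exact: offC.
  have /andP[_ h] := truncn_itv (normr_ge0 (2 * C + 4 * dl + 1)).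
  by have := ler_norm (2 * C + 4 * dl + 1); lra.
pose l := mdist (g o) o.
have [A2 UA2 A2P] := U_deep (l + dl + 1).
have [A3 UA3 A3P] := fixG g Gg (C + dl + 1).
pose A1 := A0 `&` (A2 `&` A3).
have UA1 : U A1 by apply: filterI => //; exact: filterI.
have [a1 [A0a1 [A2a1 A3a1]]] := ultra_meet UU UA0 (filterI UA2 UA3).
have C0 : 0 <= C by apply: le_trans (gp_ge0 _ _ _) (g_off _ A0a1).
pose C' := Num.max C (l + dl).
have C'C : C <= C' by rewrite le_max lexx.
have C'l : l + dl <= C' by rewrite le_max lexx orbT.
pose A' := G `&` [set f | forall a, A1 a -> gp (f o) (a o) <= C'].
(* For [c < 0] the sequence [w] itself is growing; its members need not be
   moved. *)
have grA' : growing o c e A'.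
  have [c0|c0] := ltP c 0.
    apply: growing_of_unbounded => // N.
    have [i N0i iN] := gromov_convergent_norm wc N N0.
    have [f Gf fE] := wG i; exists f; rewrite /A' /= fE //; split => // a [A0a _].
    exact: le_trans (offC _ _ N0i A0a) C'C.
  have g_fix : C + dl < gp (g (a1 o)) (a1 o) by have := A3P _ A3a1; lra.
  have := growing_away c0 e0 Gg (g_off _ A0a1) g_fix g_long (U_growing UG).
  apply: growing_sub => f [Gf /= fp]; split => // a [_ [A2a _]].
  apply: le_trans (_ : l + dl <= C') => //; apply: (gp_far dlP fp).
  by have := A2P _ _ A2a A2a1; rewrite -/l; lra.
have [U' [U'U U'A' U'gr]] := grill_ultrafilter (@growing_sub _ _ o c e)
  (@growingU _ _ o c e) grA' (@growing0 _ _ o c e).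
have U'G : U' G by apply: filterS U'A' => f [].
apply: (@schottky_of_ultrafilter _ _ _ _ dl_ge0 dlP cpt G c e G_semi e0 U' U'U U'G
  U'gr id (2 * C' + 2 * dl + 1) (isometry_id X)) => // A U'A.
apply: contrapT => nab.
have [f [Af [Gf f_off]]] := ultra_meet U'U U'A U'A'.
(* The points [f o] and [f^-1 o] are close in direction and both far from the
   direction of [a o], so [f] moves [a o] away from that direction. *)
have f_deep : 2 * C' + 2 * dl + 1 <= gp (f o) (bp f).
  by rewrite leNgt; apply/negP => h; apply: nab; exists f, f.
have [A4 UA4 A4P] := fixG f Gf (2 * C' + 2 * dl + 1).
have [a [A1a A4a]] := ultra_meet UU UA1 UA4.
have fa := f_off a A1a.
have h1 : gp (a o) (bp f) <= C' + dl.
  apply: (gp_far dlP) (_ : gp (a o) (f o) <= C') _; first by rewrite gpC.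
  by rewrite gpC; lra.
have h2 : C' + dl + 1 <= gp (f o) (f (a o)).
  by rewrite (gp_shadow _ (G_iso Gf)) gpC; have := gp_le o (f o) (bp f); lra.
have h3 : C' + dl + 1 <= gp (f (a o)) (a o) by have := A4P a A4a; lra.
by have := gp_chain dlP h2 h3; lra.
Qed.

End LimitPoint.

(** Two distinct limit points guarantee an orbit sequence that does not tend to
    the limit point of the ultrafilter, in case [G] fixes that point. *)
Lemma schottky_exponent_ge (c : R) (xi eta : boundary o) :
  limit_set o G xi -> limit_set o G eta -> xi <> eta ->
  (c%:E < entropy o G)%E ->
  exists G', [/\ G' `<=` G, schottky_semigroup o G' &
    (c%:E <= crit_exponent o G')%E].
Proof.
move=> [u xu uG] [v ev vG] xe cG.
have uc := boundary_class_convergent xu; have vc := boundary_class_convergent ev.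
have [|e e0 grG] := growing_of_entropy _ cG.
  move=> N; have [i _ iN] := gromov_convergent_norm uc N 0.
  by have [f Gf fE] := uG i; exists f; rewrite ?fE.
have [U [UU UG Ugr]] := grill_ultrafilter (@growing_sub _ _ o c e)
  (@growingU _ _ o c e) grG (@growing0 _ _ o c e).
(* [h] does not map the attracting limit point of [U] to the repelling one. *)
pose good h := exists r, forall A, U A ->
  exists a b, [/\ A a, A b & gp (h (a o)) (bp b) < r].
have use_good h : is_isometry h -> (forall f, G f -> G (h \o f)) -> good h ->
    exists G', [/\ G' `<=` G, schottky_semigroup o G' &
      (c%:E <= crit_exponent o G')%E].
  move=> hi hG [r hr].
  exact: (schottky_of_ultrafilter dl_ge0 dlP cpt G_semi e0 UU UG Ugr hi hG hr).
have [gid|bid] := pselect (good id).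
  by apply: (use_good id) => //; exact: isometry_id.
have [[h Gh gh]|bG] := pselect (exists2 h, G h & good h).
  by apply: (use_good h) => //; [exact: G_iso|move=> f; exact: G_semi.2].
have bad h : ~ good h -> forall r, exists2 A, U A &
    forall a b, A a -> A b -> r <= gp (h (a o)) (bp b).
  move=> nh r; apply: contrapT => nA; apply: nh; exists r => A UA.
  apply: contrapT => nab; apply: nA; exists A => // a b Aa Ab.
  by rewrite leNgt; apply/negP => ab; apply: nab; exists a, b.
have fixG h : G h -> forall r, exists2 A, U A &
    forall a, A a -> r <= gp (h (a o)) (a o).
  move=> Gh r; have bh : ~ good h by move=> gh; apply: bG; exists h.
  have [A UA AP] := bad h bh (r + dl); have [B UB BP] := bad id bid (r + dl).
  exists (A `&` B); first exact: filterI.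
  move=> a [Aa Ba]; have h1 := AP _ _ Aa Aa; have := BP _ _ Ba Ba; rewrite gpC => h2.
  by have := gp_chain dlP h1 h2; lra.
have := schottky_of_fixed_point UU UG Ugr e0.
have [nu|tu] := pselect (~ tends_to_limit U u); first by apply; [exact: uG| | |].
have [nv|tv] := pselect (~ tends_to_limit U v); first by apply; [exact: vG| | |].
case: xe; apply: boundary_class_inj dlP _ _ _ _ xu ev _.
by apply: tends_to_limit_equiv UU _ _ _ _; exact: contrapT.
Qed.

End FixedPoint.

Theorem mainTheorem1 (R : realType) (X : metricType R) (o : X)
    (hX : gromov_hyperbolic o)
    (hcompact : compact [set: gromov_closure o])
    (Gamma : set (X -> X))
    (hGamma : isometry_semigroup Gamma)
    (hlimit : exists xi eta : boundary o,
       [/\ limit_set o Gamma xi, limit_set o Gamma eta & xi <> eta]) :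
  ereal_sup [set crit_exponent o Gamma' | Gamma' in
    [set Gamma' : set (X -> X) |
      Gamma' `<=` Gamma /\ schottky_semigroup o Gamma']]
  = entropy o Gamma.
Proof.
have [dl dl_ge0 dlP] := hX; have [xi [eta [Lxi Leta xe]]] := hlimit.
apply/eqP; rewrite eq_le; apply/andP; split.
  apply: ge_ereal_sup => _ [G' [G'G G'S] <-].
  exact: (schottky_exponent_le_entropy dl_ge0 dlP hcompact G'G G'S).
apply: ereal_le_real => c cG.
have [G' [G'G G'S cG']] :=
  schottky_exponent_ge dl_ge0 dlP hcompact hGamma Lxi Leta xe cG.
by apply: le_trans cG' _; apply: ereal_sup_ubound; exists G'.
Qed.
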